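(* For any $\mathscr{B}\subseteq\mathbb{N}$, the set $\mathscr{B}'$ is the largest element of $Taut(\mathscr{B})$ with respect to $\prec$.
   Context: $\mathbb{N}=\{1,2,\dots\}$. For $\mathscr{A}\subseteq\mathbb{N}$: $\mathcal{M}_{\mathscr{A}}=\bigcup_{a\in\mathscr{A}}a\mathbb{Z}$, $\mathcal{F}_{\mathscr{A}}=\mathbb{Z}\setminus\mathcal{M}_{\mathscr{A}}$, $\eta_{\mathscr{A}}=\mathbf{1}_{\mathcal{F}_{\mathscr{A}}}\in\{0,1\}^{\mathbb{Z}}$, and $\mathscr{A}^{prim}$ is the set of those $a\in\mathscr{A}$ not divisible by any other element of $\mathscr{A}$. The logarithmic density $\boldsymbol{\delta}(\mathcal{M}_{\mathscr{A}})=\lim_{L\to\infty}\frac1{\ln L}\sum_{\ell\in\mathcal{M}_{\mathscr{A}}\cap[1,L]}\frac1\ell$ always exists (Davenport–Erdős). $\mathscr{A}$ is Behrend if $\boldsymbol{\delta}(\mathcal{M}_{\mathscr{A}})=1$; $\mathscr{A}$ is taut if $\boldsymbol{\delta}(\mathcal{M}_{\mathscr{A}\setminus\{a\}})<\boldsymbol{\delta}(\mathcal{M}_{\mathscr{A}})$ for every $a\in\mathscr{A}$. $\mathscr{B}'=(\mathscr{B}\cup C)^{prim}$, where $C=\{c\in\mathbb{N}:c\mathcal{A}\subseteq\mathscr{B}\text{ for some Behrend set }\mathcal{A}\}$. For $x\in\{0,1\}^{\mathbb{Z}}$, $X_x$ is the closure of $\{\sigma^kx:k\in\mathbb{Z}\}$,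 $\sigma$ being the left shift; write $\eta=\eta_{\mathscr{B}}$. Define $Taut(\mathscr{B})=\{\mathscr{C}\subseteq\mathbb{N}:\mathscr{C}\text{ is taut and }X_{\eta_{\mathscr{C}}}\subseteq X_\eta\}$, partially ordered by $\mathscr{C}_1\prec\mathscr{C}_2\iff X_{\eta_{\mathscr{C}_1}}\subseteq X_{\eta_{\mathscr{C}_2}}$. *)

(* Defs.v *)
From HB Require Import structures.
From mathcomp Require Import all_boot all_order all_algebra.
From mathcomp Require Import all_classical all_reals all_analysis.

Set Implicit Arguments.
Unset Strict Implicit.
Unset Printing Implicit Defensive.

Import Order.TTheory GRing.Theory Num.Theory.
Import numFieldNormedType.Exports.

Local Open Scope classical_set_scope.
Local Open Scope ring_scope.

(* The natural numbers here start at 1; a subset of them is a set A : set nat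
   with A `<=` posN. *)
Definition posN : set nat := [set n | (0 < n)%N].

Definition multiples (A : set nat) : set int :=
  \bigcup_(a in A) [set a%:Z * k | k in [set: int]].

Definition free_set (A : set nat) : set int := ~` multiples A.

(* {0,1}^Z with the product (pointwise convergence) topology, bool being
   discrete. *)
Definition config := {ptws int -> bool}.

Definition eta (A : set nat) : config := fun n => n \in free_set A.

Definition prim (A : set nat) : set nat :=
  [set a | A a /\ forall b, A b -> b != a -> ~~ (b %| a)%N].

(* At L = 0, 1 the term is 0 by the conventions ln 0 = 0 and 0^-1 = 0. If the
   limit did not exist, lim would return an unspecified point; by the
   Davenport-Erdos theorem it exists for all S = multiples A, A `<=` posN. *)
Definition log_density (R : realType) (S : set int) : R :=
  lim ((fun L : nat =>
    (ln (L%:R : R))^-1 * \sum_(1 <= l < L.+1 | l%:Z \in S) (l%:R : R)^-1)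
    @ \oo).

Definition behrend (R : realType) (A : set nat) : Prop :=
  A `<=` posN /\ log_density R (multiples A) = 1.

Definition taut (R : realType) (A : set nat) : Prop :=
  A `<=` posN /\
  forall a, A a ->
    log_density R (multiples (A `\ a)) < log_density R (multiples A).

Definition behrend_factors (R : realType) (B : set nat) : set nat :=
  [set c | posN c /\
    exists2 A, behrend R A & [set (c * a)%N | a in A] `<=` B].

Definition tautification (R : realType) (B : set nat) : set nat :=
  prim (B `|` behrend_factors R B).

(* The k-th power (k any integer) of the left shift (s x)_n = x_(n+1). *)
Definition sigma_pow (k : int) (x : config) : config := fun n => x (n + k).

Definition orbit_closure (x : config) : set config :=
  closure [set sigma_pow k x | k in [set: int]].

Definition Taut (R : realType) (B : set nat) : set (set nat) :=
  [set C | taut R C /\ orbit_closure (eta C) `<=` orbit_closure (eta B)].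

Definition prec (C1 C2 : set nat) : Prop :=
  orbit_closure (eta C1) `<=` orbit_closure (eta C2).

Definition is_largest (T : Type) (le : T -> T -> Prop) (S : set T) (m : T) :
  Prop := S m /\ forall c, S c -> le c m.

(* Main.v *)
Require Import Defs.
From mathcomp Require Import all_boot all_order all_algebra.
From mathcomp Require Import all_classical all_reals all_analysis.
From mathcomp Require Import zify ring lra.

Set Implicit Arguments.
Unset Strict Implicit.
Unset Printing Implicit Defensive.

(** A block argument.  The orbit closure of [eta C] is contained in that of
    [eta D] as soon as every block of [eta C] centred at 0 occurs somewhere in
    [eta D].  With B' = [tautification R B], the theorem thus amounts to: B' is
    taut; every block of [eta B'] occurs in [eta B] ([pattern_tautification]);
    and if C is taut and every block of [eta C] occurs in [eta B], then every
    block of [eta C] occurs in [eta B'] ([pattern_lift]).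

    Write M_A for the multiples of A, and A_K for the elements of A that are at
    most K.  Densities are controlled by the Davenport-Erdos theorem, in the
    form [ulog_tail]: for large K, the set M_A \ M_(A_K) has small upper
    logarithmic density.  It rests on two elementary facts: the density of the
    integers without prime factor at most x is at least of order 1 / ln x
    ([rough_dens_ge]), and the sets l * (integers without prime factor at most
    x), for l at most x, are disjoint ([rough_le_cnt]).  It follows that A is
    Behrend exactly when the complement of M_A is null ([behrendP]), and that a
    finite union of sets is Behrend only if one of them is ([behrend_bigU]).

    Tautness is used through the property [behrend_closed]: if a A is contained
    in C for a Behrend set A, then a belongs to C.  Taut sets have it, B' has it
    by construction, and it implies tautness for primitive sets.

    The engine is [free_window].  Suppose that no element of C divides any of
    the numbers gcd (k0 + j, L), where j runs over some positions of a window.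
    After division by these gcds, only the sets {a | d a in C}, for the finitely
    many divisors d of the gcds, can obstruct.  None of them is Behrend, because
    C is closed and d is not in C; hence their union is not Behrend.  By a
    zero-one law ([not_behrend_coprime]), discarding the elements that are not
    coprime to a suitable modulus Q makes the multiples of a set that is not
    Behrend arbitrarily rare.  So inside k0 + L Z there is a progression, chosen
    to consist of integers k for which the k + j avoid the primes that divide Q
    but not L, in which most k have all k + j free of C.

    For blocks of [eta B'], the ones come from [free_window] and the zeros from
    the fact that almost every multiple of an element of B' is a multiple of an
    element of B.  For a block of [eta C], a long copy of [eta C] inside [eta B]
    gives many copies of the block in [eta B]; in most of them the ones avoid
    the elements of B' up to a bound K and the high powers of small primes.
    Let L be the product of the elements of B responsible for the zeros of such
    a copy and of a high power of (W + 1)!, where W is the largest difference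
    of two positions of the block.  A prime above W + 1 cannot divide both the
    integer at a zero and the integer at a one, so the gcd of L with the integer
    at a one involves only small primes, to bounded powers; it is at most K, no
    element of B' divides it, and [free_window] applies to B'. *)

(** * Smooth parts of factorials *)

(** Each term of Legendre's formula satisfies
    (p - 1) floor(N / p^k) <= floor(N / p^(k-1)) - floor(N / p^k), and the right-hand
    sides telescope. *)
Lemma logn_fact_le p N : prime p -> (p.-1 * logn p N`! <= N)%N.
Proof.
move=> p_pr; have p_gt0 := prime_gt0 p_pr.
suff H n : p.-1 * (\sum_(1 <= k < n.+1) N %/ p ^ k) + N %/ p ^ n <= N.
  rewrite logn_fact //; exact: leq_trans (leq_addr _ _) (H N).
elim: n => [|n IHn]; first by rewrite big_nil muln0 expn0 divn1.
rewrite big_nat_recr //= mulnDr -addnA; apply: leq_trans IHn.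
rewrite leq_add2l expnSr divnMA.
have := leq_divM (N %/ p ^ n) p.
by case: p p_gt0 {p_pr} => //= p _; rewrite mulnS; lia.
Qed.

Lemma fact_leX x : x`! <= x ^ x.
Proof.
elim: x => // x IHx; rewrite factS expnS leq_mul2l /=.
by apply: (leq_trans IHx); case: x {IHx} => // x; rewrite leq_exp2r.
Qed.

(** The valuation of N! at p is at most 2 N / p, and that of x! is at least
    x / (2 p). *)
Lemma logn_fact_ratio p x N : prime p -> p <= x ->
  x * logn p N`! <= 4 * N * logn p x`!.
Proof.
move=> p_pr le_px; have p_gt1 := prime_gt1 p_pr; have p_gt0 := prime_gt0 p_pr.
have lb : x %/ p <= logn p x`!.
  rewrite logn_fact // big_ltn ?expn1 ?leq_addr //; lia.
have ub := logn_fact_le N p_pr.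
have dv : x <= 2 * p * (x %/ p).
  have := ltn_ceil x p_gt0; have : 0 < x %/ p by rewrite divn_gt0.
  nia.
have ub2 : p * logn p N`! <= 2 * N.
  by case: p p_gt1 ub {p_pr le_px p_gt0 lb dv} => //= p; nia.
apply: (@leq_trans (2 * p * (x %/ p) * logn p N`!)).
  by rewrite leq_mul2r dv orbT.
apply: (@leq_trans (4 * N * (x %/ p))); last by rewrite leq_mul2l lb orbT.
by nia.
Qed.

Definition upto (x : nat) : nat_pred := [pred p | p <= x].

(** The part of N! supported on the primes up to x is compared with the power
    x!^(4N/x); this bound plays the part of Mertens' theorem. *)
Lemma smooth_fact_le x N : 0 < x -> N`!`_(upto x) <= x ^ (4 * N).
Proof.
move=> x_gt0; rewrite -(leq_exp2r _ _ x_gt0) -expnM [4 * N * x]mulnC expnM.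
apply: (@leq_trans (x`!`_(upto x) ^ (4 * N))); last first.
  have [->|N_gt0] := posnP (4 * N); first by rewrite !expn0.
  rewrite leq_exp2r //; apply: leq_trans (fact_leX x).
  exact: dvdn_leq (fact_gt0 _) (dvdn_part _ _).
rewrite -!partnX. pose b := maxn (N`! ^ x) (x`! ^ (4 * N)).
rewrite (@widen_partn b _ (N`! ^ x)) ?leq_maxl //.
rewrite (@widen_partn b _ (x`! ^ _)) ?leq_maxr //.
apply: leq_prod => p /= le_px; have [p_pr|npr] := boolP (prime p).
  by rewrite leq_pexp2l ?prime_gt0 // !lognX logn_fact_ratio.
have l0 k : logn p k = 0 by rewrite lognE (negPf npr).
by rewrite !l0.
Qed.

(** * Counting in periodic sets and integers without small prime factors *)

Section Counting.
Implicit Types S T F : nat -> bool.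

Definition cnt (S : nat -> bool) (q : nat) : nat := \sum_(0 <= n < q) S n.
Definition has_period (q : nat) (S : nat -> bool) := forall n, S (n + q) = S n.

Lemma periodicM q S m : has_period q S -> has_period (m * q) S.
Proof.
move=> pS; elim: m => [|m IHm] n; first by rewrite addn0.
by rewrite mulSn addnA IHm pS.
Qed.

Lemma periodic_mod q S n : has_period q S -> S (n %% q) = S n.
Proof.
by move=> pS; rewrite {2}(divn_eq n q) addnC; rewrite (periodicM _ pS).
Qed.

Lemma cnt_add S m n : cnt S (m + n) = cnt S m + cnt (fun i => S (m + i)) n.
Proof.
rewrite /cnt (@big_cat_nat _ _ _ m) ?leq_addr //=; congr addn.
rewrite -{1}[m]add0n big_addn addKn.
by apply: eq_bigr => i _; rewrite addnC.
Qed.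

Lemma cnt_le S q : cnt S q <= q.
Proof.
rewrite /cnt -{2}[q]subn0 -[q - 0]muln1 -sum_nat_const_nat.
by apply: leq_sum => i _; case: (S i).
Qed.

Lemma sub_cnt S T q : (forall n, n < q -> S n -> T n) -> cnt S q <= cnt T q.
Proof.
move=> ST; rewrite /cnt !big_mkord; apply: leq_sum => i _.
by have := ST i (ltn_ord i); case: (S i) => // ->.
Qed.

Lemma eq_cnt S T q : (forall n, n < q -> S n = T n) -> cnt S q = cnt T q.
Proof. by move=> ST; apply/eqP; rewrite eqn_leq !sub_cnt // => n /ST ->. Qed.

Lemma cntM S q m : has_period q S -> cnt S (m * q) = m * cnt S q.
Proof.
move=> pS; elim: m => [|m IHm]; first by rewrite /cnt big_nil.
rewrite !mulSn addnC cnt_add IHm addnC; congr addn.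
by apply: eq_cnt => n _; rewrite addnC periodicM.
Qed.

Lemma cnt_dilate S l q : 0 < l ->
  cnt (fun n => (l %| n) && S (n %/ l)) (l * q) = cnt S q.
Proof.
move=> l_gt0; elim: q => [|q IHq]; first by rewrite muln0 /cnt !big_nil.
rewrite mulnS addnC cnt_add IHq -addn1 cnt_add; congr addn.
rewrite /cnt big_ltn // big_nat1 addn0 dvdn_mulr // mulKn //= big1_seq ?addn0 //.
move=> i /andP[_]; rewrite mem_index_iota => /andP[i_gt0 lt_il].
by rewrite dvdn_addr ?dvdn_mulr // gtnNdvd.
Qed.

Lemma periodic_coprime q : has_period q (coprime^~ q).
Proof. by move=> n; rewrite /coprime gcdnC gcdnDr gcdnC. Qed.

Lemma upto_nat_fact x : (upto x).-nat x`!.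
Proof.
apply/pnatP; rewrite ?fact_gt0 // => p p_pr; rewrite inE /=.
elim: x => [|x IHx]; first by rewrite dvdn1 => /eqP p1; rewrite p1 in p_pr.
rewrite factS Euclid_dvdM // => /orP[/dvdn_leq|/IHx]; [exact | exact: leqW].
Qed.

Lemma cnt_dilate_coprime l m q : 0 < l ->
  cnt (fun n => (l %| n) && coprime (n %/ l) q) (l * (m * q)) =
  m * cnt (coprime^~ q) q.
Proof.
by move=> l_gt0; rewrite (@cnt_dilate (coprime^~ q)) // cntM //; exact: periodic_coprime.
Qed.

(** Markov's inequality for the logarithm of the x-smooth part, whose total over
    n <= N is bounded by [smooth_fact_le]: at most half of the n <= N have an
    x-smooth part above x^8. *)
Lemma card_smooth_gt x N : 1 < x ->
  2 * (\sum_(1 <= n < N.+1) (x ^ 8 < n`_(upto x))) <= N.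
Proof.
move=> x_gt1; have x_gt0 := ltnW x_gt1.
set s := \sum_(_ <= _ < _) _.
suff : (x ^ 8) ^ s <= x ^ (4 * N) by rewrite -expnM leq_exp2l //; lia.
apply: leq_trans (smooth_fact_le N x_gt0).
suff -> : N`!`_(upto x) = \prod_(1 <= n < N.+1) n`_(upto x).
  rewrite expn_sum; apply: leq_prod => n _.
  by case: ltnP => [/ltnW|]; rewrite ?expn1 // expn0 part_gt0.
elim: N {s} => [|N IHN]; first by rewrite fact0 partn1 big_nil.
rewrite factS partnM ?fact_gt0 // IHN [RHS]big_nat_recr //; exact: mulnC.
Qed.

(** Sorting the integers n <= N = (x^8)! x! by their x-smooth part l: at least half
    of them have l <= x^8, and those with a given l are the products of l by an
    integer coprime to x!. *)
Lemma fact_le_rough x : 1 < x ->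
  (x ^ 8)`! * x`! <= 2 * \sum_(1 <= l < (x ^ 8).+1)
                           (x ^ 8)`! %/ l * cnt (coprime^~ x`!) x`!.
Proof.
move=> x_gt1; have x_gt0 := ltnW x_gt1; set y := x ^ 8.
have smooth := @card_smooth_gt x (y`! * x`!) x_gt1; rewrite -/y in smooth.
set N := y`! * x`! in smooth *.
pose P l n := (l %| n) && coprime (n %/ l) x`!.
(* Every n <= N either has a smooth part l <= y, and then satisfies P l, or is
   counted by [card_smooth_gt]. *)
have cover : N <= \sum_(1 <= n < N.+1) \sum_(1 <= l < y.+1) P l n +
             \sum_(1 <= n < N.+1) (y < n`_(upto x)).
  rewrite -big_split /= -[X in X <= _]muln1 -[X in X * _](subn1 N.+1).
  rewrite -sum_nat_const_nat big_nat [X in _ <= X]big_nat.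
  apply: leq_sum => n /andP[n_gt0 _].
  case: (leqP n`_(upto x) y) => [le_ny|_]; last by rewrite addn_gt0 orbT.
  rewrite addn0 (bigD1_seq n`_(upto x)) ?iota_uniq ?mem_index_iota ?part_gt0 //=.
  rewrite /P dvdn_part -{1}(partnC (upto x) n_gt0) mulKn ?part_gt0 //.
  by rewrite coprime_sym (pnat_coprime (upto_nat_fact x)) ?part_pnat ?addn_gt0.
rewrite exchange_big_nat /= in cover.
suff -> : \sum_(1 <= l < y.+1) y`! %/ l * cnt (coprime^~ x`!) x`! =
          \sum_(1 <= l < y.+1) \sum_(1 <= n < N.+1) P l n by lia.
apply: eq_big_nat => l /andP[l_gt0 le_ly].
rewrite -(cnt_dilate_coprime _ _ l_gt0) mulnA (mulnC l) divnK; last first.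
  by rewrite dvdn_fact // l_gt0.
rewrite -/N /cnt.
have fin : 0 < N by rewrite muln_gt0 !fact_gt0.
have fact_neq1 : (x`! == 1) = false.
  by apply/negbTE; rewrite neq_ltn [1 < _](leq_trans x_gt1) ?orbT // fact_geq.
have PN : P l N = false.
  rewrite /P /N -{2}(divnK (dvdn_fact (n := y) (m := l) _)) ?l_gt0 //.
  rewrite -mulnA mulnCA mulKn // coprimeMl [coprime x`! _]/coprime gcdnn fact_neq1.
  by rewrite !andbF.
rewrite -/(cnt (P l) N) big_nat_recr //= PN addn0 /cnt big_ltn //.
by rewrite /P dvdn0 div0n /coprime gcd0n fact_neq1.
Qed.

(** The sets l * (integers coprime to x!), for l <= x, are pairwise disjoint, and
    the one attached to l lies in S when l does. *)
Lemma rough_le_cnt x q S : 1 < x -> has_period q S ->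
  (forall l t, coprime t x`! -> S (l * t) = S l) ->
  \sum_(1 <= l < x.+1 | S l) x`! %/ l * q * cnt (coprime^~ x`!) x`!
    <= x`! * x`! * cnt S q.
Proof.
move=> x_gt1 pS invS; rewrite -cntM //.
pose P l n := (l %| n) && coprime (n %/ l) x`!.
apply: (@leq_trans (\sum_(1 <= l < x.+1 | S l) cnt (P l) (x`! * x`! * q))).
  rewrite big_nat_cond [X in _ <= X]big_nat_cond.
  apply: leq_sum => l /andP[/andP[l_gt0 le_lx] _].
  rewrite -(cnt_dilate_coprime (x`! %/ l * q) x`! l_gt0) mulnA mulnA (mulnC l) divnK ?dvdn_fact ?l_gt0 //.
  by rewrite mulnAC.
rewrite /cnt exchange_big /=; apply: leq_sum => n _.
case:
  (pickP (fun l : 'I_x.+1 => [&& 0 < l, l < x.+1 & S l && P l n]))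
  => [l /and3P[l1 lx /andP[Sl Pl]]|none]; last first.
  rewrite big_nat_cond big1 // => l /andP[/andP[l1 lx] Sl].
  by have := none (Ordinal lx); rewrite /= l1 lx Sl /= => ->.
have [ldn cop] := andP Pl; rewrite -{2}(divnK ldn) mulnC invS // Sl /=.
rewrite big_mkcond (bigD1_seq (l : nat)) ?iota_uniq ?mem_index_iota ?l1 //=.
rewrite Sl Pl big_nat_cond big1 // => k /andP[/andP[k1 kx] kl].
case: ifP => // _; case Pk : (P k n) => //; case/eqP: kl.
have [kdn copk] := andP Pk.
have cofact a b : 0 < a -> a < x.+1 -> coprime b x`! -> coprime a b.
  move=> a1 ax copb; rewrite coprime_sym (coprime_dvdr _ copb) //.
  by rewrite dvdn_fact // a1.
apply/eqP; rewrite eqn_dvd.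
have copkl := cofact _ _ k1 kx cop; have coplk := cofact _ _ l1 lx copk.
by rewrite -(Gauss_dvdl _ copkl) -(Gauss_dvdl _ coplk) [l * _]mulnC [k * _]mulnC
  !divnK // kdn.
Qed.

(** t |-> i + u t permutes the residues mod q. *)
Lemma cnt_affine T q u i : has_period q T -> coprime u q ->
  cnt (fun t => T (i + u * t)) q = cnt T q.
Proof.
case: q => [|q] pT cop; first by rewrite /cnt !big_nil.
rewrite /cnt !big_mkord; pose f (t : 'I_q.+1) := inord ((i + u * t) %% q.+1) : 'I_q.+1.
have fE t : f t = (i + u * t) %% q.+1 :> nat by rewrite inordK ?ltn_mod.
have f_inj : injective f.
  move=> s t /(congr1 val); rewrite /= !fE => /eqP; rewrite eqn_modDl.
  wlog le_ts : s t / t <= s.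
    move=> H; case: (leqP t s) => [|/ltnW] /H // K /eqP e; apply/esym/K/eqP.
    by rewrite e.
  rewrite eqn_mod_dvd ?leq_mul // -mulnBr Gauss_dvdr 1?coprime_sym //.
  have := ltn_ord s; case: (posnP (s - t)) => [st0 _ _|st_gt0 lt /(dvdn_leq st_gt0)].
    by apply/val_inj => /=; apply/eqP; rewrite eqn_leq le_ts andbT -subn_eq0 st0.
  by lia.
rewrite [RHS](reindex_inj f_inj); apply: eq_bigr => t _.
by rewrite fE periodic_mod.
Qed.

(** Periodic sets of coprime periods are independent (Chinese remainders). *)
Lemma cnt_indep S T q r : has_period q S -> has_period r T -> coprime q r ->
  cnt (fun n => S n && T n) (q * r) = cnt S q * cnt T r.
Proof.
move=> pS pT cop.
have split F m : cnt F (m * q) = \sum_(0 <= j < m) cnt (fun i => F (j * q + i)) q.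
  elim: m => [|m IHm]; first by rewrite /cnt !big_nil.
  by rewrite mulSn addnC cnt_add IHm big_nat_recr.
rewrite mulnC split /cnt exchange_big /= big_distrl /=.
apply: eq_bigr => i _; rewrite -/(cnt T r) -(cnt_affine i pT cop) /cnt big_distrr /=.
apply: eq_bigr => j _; rewrite addnC periodicM // mulnb.
by rewrite (mulnC j).
Qed.
End Counting.

Import Order.TTheory GRing.Theory Num.Theory.
Import numFieldNormedType.Exports.

Local Open Scope classical_set_scope.
Local Open Scope ring_scope.

(** * Harmonic sums over periodic sets *)

Section LogDensity.
Variable R : realType.
Implicit Types (S T : nat -> bool) (e f : R).

Definition harm S (x : nat) : R := \sum_(1 <= l < x.+1 | S l) l%:R^-1.

(** Upper logarithmic density at most e, with a bounded error.  The error term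
    absorbs finite modifications and dilations of the variable, which makes the
    notion stable under [ulogU] and [ulog_comp]. *)
Definition ulog S e := exists C : R, forall x : nat, (0 < x)%N ->
  harm S x <= e * ln x%:R + C.

Lemma harm_ge0 S x : 0 <= harm S x.
Proof. by apply: sumr_ge0 => l _; rewrite invr_ge0. Qed.

Lemma sub_harm S T x : (forall n, (0 < n)%N -> (n <= x)%N -> S n -> T n) ->
  harm S x <= harm T x.
Proof.
move=> ST; rewrite /harm big_nat_cond [leRHS]big_nat_cond.
rewrite big_mkcond [leRHS]big_mkcond /=; apply: ler_sum => l _.
case: ifP => [/andP[/andP[l1 lx] Sl]|_].
  by rewrite l1 lx (ST l).
by case: ifP => // _; rewrite invr_ge0.
Qed.

Lemma harm_split S T x :
  harm S x = harm (fun n => S n && T n) x + harm (fun n => S n && ~~ T n) x.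
Proof. by rewrite /harm (bigID T). Qed.

Lemma harmU S T x : harm (fun n => S n || T n) x <= harm S x + harm T x.
Proof.
rewrite (harm_split _ S); apply: lerD; apply: sub_harm => n _ _.
  by case/andP.
by case: (S n) (T n) => [] [].
Qed.

Lemma harm_recr S x : harm S x.+1 = harm S x + (if S x.+1 then x.+1%:R^-1 else 0).
Proof. by rewrite /harm big_mkcond big_nat_recr //= -big_mkcond. Qed.

Lemma harm0 S : harm S 0 = 0.
Proof. by rewrite /harm big_nil. Qed.

Lemma harm_incr S x y : (x <= y)%N -> harm S x <= harm S y.
Proof.
elim: y => [|y IHy]; first by rewrite leqn0 => /eqP ->.
rewrite leq_eqVlt => /predU1P[-> //|/IHy /le_trans]; apply.
by rewrite harm_recr lerDl; case: ifP => // _; rewrite invr_ge0.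
Qed.

Lemma ln_nat_ge0 (x : nat) : 0 <= ln x%:R :> R.
Proof.
case: x => [|x]; first by rewrite ln0.
by rewrite ln_ge0 // ler1n.
Qed.

Lemma harmT_le x : (0 < x)%N -> harm xpredT x <= 1 + ln x%:R.
Proof.
elim: x => // -[_ _|x IHx _]; first by rewrite harm_recr harm0 ln1 invr1; lra.
rewrite harm_recr (le_trans (lerD (IHx _) (lexx _))) //.
rewrite -addrA lerD2l.
have a0 : (0 : R) < x.+1%:R by rewrite ltr0n.
have b0 : (0 : R) < x.+2%:R by rewrite ltr0n.
have h : -1 < - (x.+2%:R : R)^-1.
  by rewrite ltrN2 invf_lt1 // ltr1n.
have := le_ln1Dx h.
have -> : 1 + - (x.+2%:R : R)^-1 = x.+1%:R / x.+2%:R.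
  have E : x.+2%:R = x.+1%:R + 1 :> R by rewrite natr1.
  by rewrite E; field; apply: lt0r_neq0; move: a0; rewrite -natr1; lra.
rewrite ln_div ?posrE //; move: (ln _) (ln _) (_^-1) => u v w ?; lra.
Qed.

Lemma harmT_ge x : (0 < x)%N -> ln x%:R <= harm xpredT x.
Proof.
move=> x1; suff : ln x.+1%:R <= harm xpredT x.
  by apply: le_trans; rewrite ler_ln ?posrE ?ltr0n // ler_nat.
elim: x {x1} => [|x IHx]; first by rewrite harm0 ln1.
rewrite harm_recr; apply: le_trans (lerD IHx (lexx _)).
have a0 : (0 : R) < x.+1%:R by rewrite ltr0n.
have b0 : (0 : R) < x.+2%:R by rewrite ltr0n.
have h : -1 < (x.+1%:R : R)^-1 by rewrite (lt_trans _ (_ : 0 < _)) ?invr_gt0 //; lra.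
have := le_ln1Dx h.
have -> : 1 + (x.+1%:R : R)^-1 = x.+2%:R / x.+1%:R.
  have E : x.+2%:R = x.+1%:R + 1 :> R by rewrite natr1.
  by rewrite E; field; apply: lt0r_neq0; move: a0; rewrite -natr1; lra.
rewrite ln_div ?posrE //; move: (ln _) (ln _) (_^-1) => u v w ?; lra.
Qed.

(** Abel summation. *)
Lemma harm_discrepancy S (d C : R) x :
  (forall n, `|(cnt (fun k => S k.+1) n)%:R - d * n%:R| <= C) ->
  `|harm S x - d * harm xpredT x| <= C.
Proof.
move=> disc; pose F n : R := (cnt (fun k => S k.+1) n)%:R - d * n%:R.
have FS n : F n.+1 = F n + (S n.+1)%:R - d.
  by rewrite /F /cnt big_nat_recr //= natrD -(natr1 n); ring.
(* Summation by parts turns the harmonic sum of the discrepancy into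
   F n / (n + 1) plus the sum of the F l (1 / l - 1 / (l + 1)); G is the latter. *)
pose G n : R := harm S n - d * harm xpredT n - F n / n.+1%:R.
have C0 : 0 <= C := le_trans (normr_ge0 _) (disc 0%N).
suff GP n : `|G n| <= C * (1 - n.+1%:R^-1).
  have -> : harm S x - d * harm xpredT x = G x + F x / x.+1%:R.
    by rewrite /G subrK.
  apply: (le_trans (ler_normD _ _)); apply: (le_trans (lerD (GP x) (lexx _))).
  rewrite normrM normfV [`|x.+1%:R|]ger0_norm //.
  have : `|F x| / x.+1%:R <= C / x.+1%:R by rewrite ler_wpM2r ?invr_ge0 ?disc.
  by move: (x.+1%:R^-1) => v ?; lra.
elim: n => [|n IHn].
  by rewrite /G !harm0 /F /cnt big_nil !mulr0 invr1 !subrr mul0r subrr normr0 mulr0.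
have a0 : (0 : R) < n.+1%:R by rewrite ltr0n.
have b0 : (0 : R) < n.+2%:R by rewrite ltr0n.
have GS : G n.+1 = G n + F n.+1 * (n.+1%:R^-1 - n.+2%:R^-1).
  rewrite /G !harm_recr FS.
  have -> : (if S n.+1 then n.+1%:R^-1 else 0) = (S n.+1)%:R * n.+1%:R^-1 :> R.
    by case: ifP; rewrite ?mul1r ?mul0r.
  by field; rewrite !lt0r_neq0.
rewrite GS; apply: (le_trans (ler_normD _ _)).
have inv_le : (n.+2%:R : R)^-1 <= n.+1%:R^-1 by rewrite lef_pV2 ?posrE // ler_nat.
have : `|F n.+1 * (n.+1%:R^-1 - n.+2%:R^-1)| <= C * (n.+1%:R^-1 - n.+2%:R^-1).
  rewrite normrM [X in _ * X]ger0_norm ?subr_ge0 //.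
  by rewrite ler_wpM2r ?subr_ge0 ?disc.
by move: IHn; move: (n.+1%:R^-1) (n.+2%:R^-1) => u v ? ?; lra.
Qed.

Definition dens S (q : nat) : R := (cnt S q)%:R / q%:R.

Lemma dens_ge0 S q : 0 <= dens S q.
Proof. by rewrite divr_ge0. Qed.

Lemma dens_le1 S q : (0 < q)%N -> dens S q <= 1.
Proof. by move=> q0; rewrite ler_pdivrMr ?ltr0n // mul1r ler_nat cnt_le. Qed.

Lemma periodic_discrepancy S q n : (0 < q)%N -> has_period q S ->
  `|(cnt S n)%:R - dens S q * n%:R| <= q%:R :> R.
Proof.
move=> q0 pS; have qR : (0 : R) < q%:R by rewrite ltr0n.
rewrite {1}(divn_eq n q) cnt_add cntM // natrD natrM.
rewrite [in n%:R](divn_eq n q) natrD natrM.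
set c := (cnt _ (n %% q))%:R.
have -> : (n %/ q)%:R * (cnt S q)%:R + c -
   dens S q * ((n %/ q)%:R * q%:R + (n %% q)%:R) = c - dens S q * (n %% q)%:R.
  by rewrite /dens; field; rewrite lt0r_neq0.
have rq : ((n %% q)%:R : R) <= q%:R by rewrite ler_nat ltnW // ltn_mod.
have c0 : 0 <= c by rewrite ler0n.
have cq : c <= q%:R by rewrite (le_trans _ rq) // ler_nat cnt_le.
have := dens_ge0 S q; have := dens_le1 S q0; have r0 : (0 : R) <= (n %% q)%:R by [].
move=> d1 d0; rewrite ler_norml; apply/andP; split; nra.
Qed.

Lemma harm_periodic S q : (0 < q)%N -> has_period q S ->
  exists C : R, forall x, (0 < x)%N -> `|harm S x - dens S q * ln x%:R| <= C.
Proof.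
move=> q0 pS; exists (q%:R + 1) => x x0.
have pS' : has_period q (fun k => S k.+1) by move=> n; rewrite -addSn pS.
have dS' : dens (fun k => S k.+1) q = dens S q.
  rewrite /dens -(@cnt_affine S q 1 1 pS) ?coprime1n //.
  by congr (_%:R / _); apply: eq_cnt => n _; rewrite mul1n.
have disc n : `|(cnt (fun k => S k.+1) n)%:R - dens S q * n%:R| <= q%:R :> R.
  by rewrite -dS' periodic_discrepancy.
have := @harm_discrepancy S _ _ x disc.
have := harmT_le x0; have := harmT_ge x0.
have := dens_ge0 S q; have := dens_le1 S q0.
rewrite !ler_norml => d1 d0 H1 H2 /andP[H3 H4]; apply/andP; split; nra.
Qed.
End LogDensity.

(** * Upper logarithmic density *)

Section Ulog.
Variable R : realType.
Implicit Types (S T : nat -> bool) (e f : R).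

Lemma ulog_sub S T e : (forall n, (0 < n)%N -> S n -> T n) -> ulog T e -> ulog S e.
Proof.
move=> ST [C HC]; exists C => x x0; apply: le_trans (HC x x0).
by apply: sub_harm => n n0 _; apply: ST.
Qed.

Lemma ulog_le S e f : e <= f -> ulog S e -> ulog S f.
Proof.
move=> ef [C HC]; exists C => x x0; apply: (le_trans (HC x x0)).
by rewrite lerD2r ler_wpM2r // ln_nat_ge0.
Qed.

Lemma ulogU S T e f : ulog S e -> ulog T f -> ulog (fun n => S n || T n) (e + f).
Proof.
move=> [C HC] [D HD]; exists (C + D) => x x0.
apply: (le_trans (harmU _ _ _ _)); have := HC x x0; have := HD x x0; nra.
Qed.

Lemma ulog_periodic S q : (0 < q)%N -> has_period q S -> ulog S (dens R S q).
Proof.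
move=> q0 pS; have [C HC] := harm_periodic R q0 pS; exists C => x x0.
by have := HC x x0; rewrite ler_norml => /andP[_]; lra.
Qed.

Lemma ln_nat_large (M : R) : exists N : nat, forall x : nat, (N <= x)%N -> M <= ln x%:R.
Proof.
exists (Num.truncn (expR M)).+1 => x Nx.
have eM : expR M < x%:R.
  by apply: (lt_le_trans (truncnS_gt _)); rewrite ler_nat.
by rewrite -{1}(expRK M) ler_ln ?posrE ?expR_gt0 ?(lt_trans (expR_gt0 M)) // ltW.
Qed.

Lemma ln_bounded_le0 (a C : R) :
  (forall x : nat, (0 < x)%N -> a * ln x%:R <= C) -> a <= 0.
Proof.
move=> H; rewrite leNgt; apply/negP => a0.
have [N HN] := ln_nat_large ((C + 1) / a).
have := HN N.+1 (leqnSn N); rewrite ler_pdivrMr // => H1.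
have := H N.+1 isT; lra.
Qed.

Lemma dens_le_ulog S q e : (0 < q)%N -> has_period q S -> ulog S e ->
  dens R S q <= e.
Proof.
move=> q0 pS [C HC]; have [D HD] := harm_periodic R q0 pS.
rewrite -subr_le0; apply: (@ln_bounded_le0 _ (C + D)) => x x0.
have := HC x x0; have := HD x x0; rewrite ler_norml => /andP[]; lra.
Qed.

Lemma ulogT e : ulog xpredT e -> 1 <= e.
Proof.
move=> [C HC]; rewrite -subr_le0; apply: (@ln_bounded_le0 _ C) => x x0.
have := HC x x0; have := harmT_ge R x0; lra.
Qed.

Lemma ulog_exists S e : e < 1 -> ulog S e -> exists2 n, (0 < n)%N & ~~ S n.
Proof.
move=> e1 uS; apply: contrapT => H; suff /ulogT : ulog xpredT e by rewrite leNgt e1.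
apply: ulog_sub uS => n n0 _; apply: contrapT => /negP Sn; apply: H; by exists n.
Qed.

Lemma ler_sum_sub (s s' : seq nat) (F : nat -> R) : uniq s -> uniq s' ->
  {subset s <= s'} -> (forall l, 0 <= F l) ->
  \sum_(l <- s) F l <= \sum_(l <- s') F l.
Proof.
move=> us us' ss F0; rewrite [leRHS](bigID (mem s)) /= -[leRHS]addrC.
rewrite -[X in _ <= _ + X]big_filter.
have -> : \sum_(l <- [seq l <- s' | l \in s]) F l = \sum_(l <- s) F l.
  apply: perm_big; apply: uniq_perm; rewrite ?filter_uniq // => l.
  by rewrite mem_filter andb_idr // => /ss.
by rewrite lerDr sumr_ge0.
Qed.

(** Composition with a map of at most linear growth inflates the density by at
    most the slope, since 1 / t <= c / g t. *)
Lemma ulog_comp S (g : nat -> nat) (c t0 : nat) e : injective g ->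
  (forall t, (0 < t)%N -> (0 < g t)%N) ->
  (forall t, (t0 <= t)%N -> (g t <= c * t)%N) ->
  ulog S e -> ulog (fun t => S (g t)) (c%:R * e).
Proof.
move=> g_inj g_gt0 g_le [C HC].
have c0 : (0 < c)%N.
  rewrite lt0n; apply/eqP => c0; have := g_le t0.+1 (leqnSn t0).
  by rewrite c0 mul0n leqNgt g_gt0.
have cR : (0 : R) < c%:R by rewrite ltr0n.
exists (harm R xpredT t0 + c%:R * (e * ln c%:R + C)) => x x0.
apply: (@le_trans _ _ (harm R xpredT t0 + c%:R * harm R S (c * x))); last first.
  have := HC (c * x)%N; rewrite muln_gt0 c0 x0 => /(_ isT).
  rewrite natrM lnM ?posrE ?ltr0n // => H.
  have : c%:R * harm R S (c * x) <= c%:R * (e * (ln c%:R + ln x%:R) + C).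
    by rewrite ler_wpM2l // ltW.
  lra.
pose F l : R := if S l then c%:R * l%:R^-1 else 0.
have F0 l : 0 <= F l by rewrite /F; case: ifP => // _; rewrite mulr_ge0 ?invr_ge0 // ltW.
pose s := [seq t <- index_iota 1 x.+1 | (t0 < t)%N].
apply: (@le_trans _ _ (harm R (fun t => (t <= t0)%N) x + \sum_(t <- s) F (g t))).
  rewrite /harm /s big_filter big_mkcond [X in _ <= X + _]big_mkcond.
  rewrite [X in _ <= _ + X]big_mkcond -big_split /= big_nat_cond [leRHS]big_nat_cond.
  apply: ler_sum => t /andP[/andP[t1 tx] _].
  have [tt|tt] := leqP t t0.
    by rewrite addr0; case: ifP => // _; rewrite invr_ge0.
  rewrite add0r /F; case: ifP => // St.
  rewrite ler_pdivlMr ?ltr0n ?g_gt0 // mulrC ler_pdivrMr ?ltr0n //.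
  by rewrite -natrM ler_nat g_le // ltnW.
apply: lerD.
  have [tx|/ltnW xt] := leqP x t0.
    by apply: le_trans (harm_incr _ _ tx); apply: sub_harm.
  rewrite {1}/harm (big_cat_nat _ (n := t0.+1)) //= [X in _ + X]big1_seq ?addr0.
    exact: sub_harm.
  by move=> i /andP[it]; rewrite mem_index_iota ltnNge it.
rewrite -(big_map g xpredT F) mulr_sumr [leRHS]big_mkcond /=.
apply: ler_sum_sub => //.
- by rewrite map_inj_uniq ?filter_uniq ?iota_uniq.
- exact: iota_uniq.
- move=> l /mapP[t]; rewrite mem_filter mem_index_iota => /and3P[tt t1 tx] ->.
  rewrite mem_index_iota g_gt0 // ltnS (leq_trans (g_le _ (ltnW tt))) //.
  by rewrite leq_mul2l -ltnS tx orbT.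
Qed.

Definition logavg S (L : nat) : R := (ln L%:R)^-1 * harm R S L.
(** Lower counterpart of [ulog]. *)
Definition llog S e := exists C : R, forall x : nat, (0 < x)%N ->
  e * ln x%:R - C <= harm R S x.

Lemma cvg_logavg S (D : R) : (forall e, 0 < e -> ulog S (D + e)) ->
  (forall e, 0 < e -> llog S (D - e)) -> logavg S @ \oo --> D.
Proof.
move=> up low; apply/cvgrPdist_le => e e0.
have e2 : 0 < e / 2 by rewrite divr_gt0.
have [C HC] := up _ e2; have [E HE] := low _ e2.
have [N HN] := ln_nat_large (1 + (`|C| + `|E|) / (e / 2)).
near=> x.
have Nx : (N.+1 <= x)%N by near: x; exact: nbhs_infty_ge.
have x0 : (0 < x)%N by apply: leq_trans Nx.
have lx := HN x (ltnW Nx).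
have ln0 : 0 < ln x%:R :> R.
  by apply: lt_le_trans lx; rewrite ltr_wpDr // divr_ge0 ?addr_ge0 // ltW.
have {}lx : `|C| + `|E| <= (e / 2) * ln x%:R.
  by rewrite mulrC -ler_pdivrMr //; lra.
have := HC x x0; have := HE x x0; rewrite /logavg => h1 h2.
rewrite distrC ler_norml mulrC; apply/andP; split.
  rewrite lerBrDr ler_pdivlMr //; have := ler_norm E; have := normr_ge0 C; lra.
rewrite lerBlDr ler_pdivrMr //; have := ler_norm C; have := normr_ge0 E; lra.
Unshelve. all: by end_near.
Qed.

Lemma cvg_logavg_near S (D : R) e : logavg S @ \oo --> D -> 0 < e ->
  exists N : nat, forall x : nat, (N <= x)%N ->
  (D - e) * ln x%:R <= harm R S x <= (D + e) * ln x%:R.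
Proof.
move=> /cvgrPdist_le cv e0; have [N _ HN] := cv e e0.
have [M HM] := ln_nat_large 1.
exists (maxn N M) => x; rewrite geq_max => /andP[Nx Mx].
have ln0 : 0 < ln x%:R :> R by apply: lt_le_trans (HM x Mx).
have := HN x Nx; rewrite /logavg distrC ler_norml mulrC => /andP[].
rewrite lerBrDr lerBlDr ler_pdivlMr // ler_pdivrMr // => h1 h2.
by apply/andP; split; lra.
Qed.

Lemma cvg_logavg_ulog S (D : R) e : logavg S @ \oo --> D -> 0 < e -> ulog S (D + e).
Proof.
move=> cv e0; have [N HN] := cvg_logavg_near cv e0.
exists (harm R xpredT N + `|D + e| * ln N%:R) => x x0.
have [/HN/andP[_ h]|/ltnW xN] := leqP N x.
  by rewrite (le_trans h) // lerDl addr_ge0 ?harm_ge0 // mulr_ge0 // ln_nat_ge0.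
have : harm R S x <= harm R xpredT N.
  by apply: le_trans (harm_incr _ _ xN); apply: sub_harm.
have lxN : ln x%:R <= ln N%:R :> R.
  by rewrite ler_ln ?posrE ?ltr0n ?(leq_trans x0) // ler_nat.
have := ln_nat_ge0 R x; have := ler_norm (- (D + e)); rewrite normrN.
move=> n1 lx0 h; have := normr_ge0 (D + e); nra.
Qed.

Lemma cvg_logavg_llog S (D : R) e : logavg S @ \oo --> D -> 0 < e -> llog S (D - e).
Proof.
move=> cv e0; have [N HN] := cvg_logavg_near cv e0.
exists (`|D - e| * ln N%:R) => x x0.
have [/HN/andP[h _]|/ltnW xN] := leqP N x.
  by rewrite (le_trans _ h) // lerBlDr lerDl mulr_ge0 // ln_nat_ge0.
have lxN : ln x%:R <= ln N%:R :> R.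
  by rewrite ler_ln ?posrE ?ltr0n ?(leq_trans x0) // ler_nat.
have p1 : (D - e) * ln x%:R <= `|D - e| * ln x%:R.
  by rewrite ler_wpM2r ?ln_nat_ge0 ?ler_norm.
have p2 : `|D - e| * ln x%:R <= `|D - e| * ln N%:R by rewrite ler_wpM2l.
by have := harm_ge0 R S x; lra.
Qed.

End Ulog.

(** * The Davenport-Erdos theorem *)

(** Divisibility in nat; an integer is a multiple of A exactly when its absolute
    value satisfies [mults A]. *)
Definition mults (A : set nat) (n : nat) : bool :=
  `[< exists2 a, A a & (a %| n)%N >].

Definition trunc (A : set nat) (K : nat) : set nat := [set a | A a /\ (a <= K)%N].

Lemma multsP A n : reflect (exists2 a, A a & (a %| n)%N) (mults A n).
Proof. exact: asboolP. Qed.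

Lemma sub_mults A B n : A `<=` B -> mults A n -> mults B n.
Proof. by move=> AB /multsP[a Aa an]; apply/multsP; exists a => //; exact: AB. Qed.

Lemma mults_dvd A m n : (m %| n)%N -> mults A m -> mults A n.
Proof.
by move=> mn /multsP[a Aa am]; apply/multsP; exists a => //; exact: dvdn_trans mn.
Qed.

Lemma trunc_sub A K : trunc A K `<=` A.
Proof. by move=> a []. Qed.

Lemma trunc_mono A K L : (K <= L)%N -> trunc A K `<=` trunc A L.
Proof. by move=> KL a [Aa aK]; split => //; exact: leq_trans KL. Qed.

Lemma has_period_mults A q : (forall a, A a -> (a %| q)%N) -> has_period q (mults A).
Proof.
move=> Aq n; apply/multsP/multsP => -[a Aa an]; exists a => //.
  by rewrite dvdn_addl ?Aq in an.
by rewrite dvdn_addl ?Aq.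
Qed.

Lemma has_period_trunc A K L : A `<=` posN -> (K <= L)%N ->
  has_period L`! (mults (trunc A K)).
Proof.
move=> Apos KL; apply: has_period_mults => a [Aa aK].
by apply: dvdn_fact; rewrite (leq_trans aK KL) andbT; exact: Apos.
Qed.

Lemma has_period_andN q S T : has_period q S -> has_period q T ->
  has_period q (fun n => S n && ~~ T n).
Proof. by move=> pS pT n; rewrite pS pT. Qed.

Lemma has_periodN q S : has_period q S -> has_period q (fun n => ~~ S n).
Proof. by move=> pS n; rewrite pS. Qed.

Section DavenportErdos.
Variable R : realType.
Implicit Types (S T : nat -> bool) (A : set nat) (e : R).

Lemma dens_diff S T q : (forall n, T n -> S n) ->
  dens R (fun n => S n && ~~ T n) q = dens R S q - dens R T q.
Proof.
move=> TS; rewrite /dens -mulrBl; congr (_ / _).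
apply/eqP; rewrite eq_sym subr_eq -natrD; apply/eqP; congr (_%:R).
rewrite /cnt -big_split; apply: eq_bigr => n _ /=.
by have := TS n; case: (S n) (T n) => [] [] // /(_ isT).
Qed.

Lemma densM S q m : (0 < m)%N -> has_period q S -> dens R S (m * q) = dens R S q.
Proof.
move=> m0 pS; rewrite /dens cntM // !natrM -mulf_div divff ?mul1r //.
by rewrite pnatr_eq0 -lt0n.
Qed.

Lemma dens_fact S K L : (K <= L)%N -> has_period K`! S -> dens R S L`! = dens R S K`!.
Proof.
move=> KL pS; have dv : (K`! %| L`!)%N.
  by apply/dvdnP; exists (\prod_(K.+1 <= k < L.+1) k)%N; rewrite mulnC -fact_split.
by rewrite -(divnK dv) densM // divn_gt0 ?fact_gt0 // dvdn_leq // fact_gt0.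
Qed.

Lemma harm_natdiv S x N c : (forall l, (0 < l <= x)%N -> (l %| N)%N) ->
  (\sum_(1 <= l < x.+1 | S l) N %/ l * c)%N%:R = N%:R * c%:R * harm R S x.
Proof.
move=> dv; rewrite /harm /harm mulr_sumr natr_sum.
rewrite big_nat_cond [RHS]big_nat_cond; apply: eq_bigr => l /andP[/andP[l1 lx] _].
have [|k ->] := dvdnP (dv l _); first by rewrite l1.
rewrite mulnK // !natrM; field; by rewrite pnatr_eq0 -lt0n.
Qed.

Definition rough_dens (x : nat) : R := dens R (coprime^~ x`!) x`!.

(** A lower bound of order 1 / ln x for the product of the 1 - 1/p over p <= x. *)
Lemma rough_dens_ge x : (1 < x)%N -> 1 <= 2 * (1 + 8 * ln x%:R) * rough_dens x.
Proof.
move=> x1; have := fact_le_rough x1.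
rewrite -(ler_nat R) 2!natrM harm_natdiv; last first.
  by move=> l lx; exact: dvdn_fact.
have y0 : (0 < x ^ 8)%N by rewrite expn_gt0 ltnW.
have := harmT_le R y0; set H := harm R _ _.
rewrite natrX lnXn ?ltr0n ?(ltnW x1) // => Hle.
rewrite /rough_dens /dens; set c := (cnt _ _)%:R.
have f0 : (0 : R) < x`!%:R by rewrite ltr0n fact_gt0.
have g0 : (0 : R) < (x ^ 8)`!%:R by rewrite ltr0n fact_gt0.
have c0 : 0 <= c by rewrite ler0n.
move=> le1; rewrite mulrA ler_pdivlMr // mul1r.
have : x`!%:R <= 2 * c * H.
  by rewrite -(ler_pM2l g0); apply: (le_trans le1); rewrite le_eqVlt; apply/orP; left; apply/eqP; ring.
have {}Hle : H <= 1 + 8 * ln x%:R by rewrite mulr_natl.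
move=> H2; have H3 := ler_wpM2l c0 Hle; lra.
Qed.

(** Harmonic sums up to x are controlled by the natural density, up to a factor of
    order ln x, for sets determined by divisibility by integers up to x. *)
Lemma harm_le_dens S q x : (1 < x)%N -> (0 < q)%N -> has_period q S ->
  (forall l t, coprime t x`! -> S (l * t)%N = S l) ->
  harm R S x <= 2 * (1 + 8 * ln x%:R) * dens R S q.
Proof.
move=> x1 q0 pS inv; have := rough_le_cnt x1 pS inv.
rewrite -(ler_nat R) => H1.
have E : (\sum_(1 <= l < x.+1 | S l) x`! %/ l * q * cnt (coprime^~ x`!) x`!)%N%:R =
   x`!%:R * (q * cnt (coprime^~ x`!) x`!)%N%:R * harm R S x.
  rewrite -harm_natdiv; last by move=> l lx; exact: dvdn_fact.
  by congr (_%:R); apply: eq_bigr => l _; rewrite mulnA.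
move: H1; rewrite E => {E}.
have rg := rough_dens_ge x1.
have f0 : (0 : R) < x`!%:R by rewrite ltr0n fact_gt0.
have qR : (0 : R) < q%:R by rewrite ltr0n.
have cE : (cnt (coprime^~ x`!) x`!)%:R = rough_dens x * x`!%:R.
  by rewrite /rough_dens /dens divfK // lt0r_neq0.
have dE : (cnt S q)%:R = dens R S q * q%:R.
  by rewrite /dens divfK // lt0r_neq0.
rewrite !natrM cE dE => H1.
have {H1} H2 : harm R S x * rough_dens x <= dens R S q.
  have P0 : 0 < x`!%:R * x`!%:R * q%:R :> R by rewrite !mulr_gt0.
  by rewrite -(ler_pM2l P0); move: H1; lra.
have h0 := harm_ge0 R S x.
have k0 : 0 <= 2 * (1 + 8 * ln x%:R) :> R.
  by rewrite mulr_ge0 // addr_ge0 // mulr_ge0 // ln_nat_ge0.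
apply: (@le_trans _ _ (2 * (1 + 8 * ln x%:R) * (harm R S x * rough_dens x))); last first.
  by rewrite ler_wpM2l.
by rewrite mulrCA ler_peMr.
Qed.

Definition dtrunc A K : R := dens R (mults (trunc A K)) K`!.

Lemma dtrunc_le1 A K : dtrunc A K <= 1.
Proof. by rewrite dens_le1 // fact_gt0. Qed.

Lemma dtruncE A K L : A `<=` posN -> (K <= L)%N ->
  dtrunc A K = dens R (mults (trunc A K)) L`!.
Proof. by move=> Ap KL; rewrite /dtrunc -(dens_fact KL) //; exact: has_period_trunc. Qed.

Lemma dtrunc_sup A : has_sup (range (dtrunc A)).
Proof.
split; first by exists (dtrunc A 0), 0%N.
by exists 1 => _ [K _ <-]; exact: dtrunc_le1.
Qed.

Definition dsup A : R := sup (range (dtrunc A)).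

Lemma dtrunc_le_sup A K : dtrunc A K <= dsup A.
Proof. by apply: sup_upper_bound; [exact: dtrunc_sup | exists K]. Qed.

Lemma dtrunc_near_sup A e : 0 < e -> exists K, dsup A - e < dtrunc A K.
Proof.
by move=> e0; have [_ [K _ <-] H] := sup_adherent e0 (dtrunc_sup A); exists K.
Qed.

(** Up to x, the difference M_A \ M_(A_K) coincides with M_(A_x) \ M_(A_K), a
    periodic set whose density is at most [dsup A] minus that of M_(A_K); then
    [harm_le_dens] applies. *)
Lemma ulog_tail_near A e K : A `<=` posN -> 0 < e -> dsup A - e / 16 < dtrunc A K ->
  ulog (fun n => mults A n && ~~ mults (trunc A K) n) e.
Proof.
move=> Ap e0 HK.
set U := fun n => _ && _.
exists (e / 8 + harm R xpredT K.+2) => x x0.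
have := harm_ge0 R xpredT K.+2 => HT0; have lx := ln_nat_ge0 R x.
have [lt_xK|le_Kx] := ltnP x K.+2.
  apply: (@le_trans _ _ (harm R xpredT K.+2)).
    by apply: le_trans (harm_incr _ _ (ltnW lt_xK)); exact: sub_harm.
  by rewrite addrA lerDr addr_ge0 ?mulr_ge0 // ?ltW // divr_gt0.
pose S n := mults (trunc A x) n && ~~ mults (trunc A K) n.
have Kx : (K <= x)%N by lia.
have pS : has_period x`! S by apply: has_period_andN; exact: has_period_trunc.
have US : harm R U x <= harm R S x.
  apply: sub_harm => n n0 nx /andP[/multsP[a Aa an] NK]; apply/andP; split => //.
  by apply/multsP; exists a => //; split => //; exact: leq_trans (dvdn_leq n0 an) nx.
have inv l t : coprime t x`! -> S (l * t)%N = S l.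
  move=> cop; have M L : (L <= x)%N -> mults (trunc A L) (l * t)%N = mults (trunc A L) l.
    move=> Lx; apply/idP/idP; last by apply: mults_dvd; exact: dvdn_mulr.
    move=> /multsP[a [Aa aL] alt]; apply/multsP; exists a => //.
    rewrite Gauss_dvdl // in alt; rewrite coprime_sym (coprime_dvdr _ cop) // dvdn_fact //.
    by rewrite (leq_trans aL) // andbT; exact: Ap.
  by rewrite /S !M.
have x1 : (1 < x)%N by lia.
have := harm_le_dens x1 (fact_gt0 x) pS inv.
rewrite dens_diff; last by move=> n; exact/sub_mults/trunc_mono.
rewrite -(dtruncE Ap Kx) -(dtruncE Ap (leqnn x)) => H.
have ds : dtrunc A x - dtrunc A K <= e / 16.
  by have := dtrunc_le_sup A x; lra.
apply: (le_trans US); apply: (le_trans H).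
have k0 : 0 <= 2 * (1 + 8 * ln x%:R) :> R.
  by rewrite mulr_ge0 // addr_ge0 // mulr_ge0.
apply: (@le_trans _ _ (2 * (1 + 8 * ln x%:R) * (e / 16))); first by rewrite ler_wpM2l.
by move: HT0; lra.
Qed.

Lemma ulog_tail A e : A `<=` posN -> 0 < e ->
  exists K, ulog (fun n => mults A n && ~~ mults (trunc A K) n) e.
Proof.
move=> Ap e0; have e16 : 0 < e / 16 by rewrite divr_gt0.
by have [K HK] := dtrunc_near_sup A e16; exists K; exact: ulog_tail_near.
Qed.

Lemma davenport_erdos A : A `<=` posN -> logavg R (mults A) @ \oo --> dsup A.
Proof.
move=> Ap; apply: cvg_logavg => e e0.
  have [K HK] := ulog_tail Ap e0.
  apply: (@ulog_sub _ _ (fun n => mults (trunc A K) n || (mults A n && ~~ mults (trunc A K) n))).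
    by move=> n _ ->; case: (mults _ n).
  apply: ulogU => //.
  apply: ulog_le (dtrunc_le_sup A K) _.
  by apply: ulog_periodic; [exact: fact_gt0 | exact: has_period_trunc].
have [K HK] := dtrunc_near_sup A e0.
have [C HC] := harm_periodic R (fact_gt0 K) (has_period_trunc Ap (leqnn K)).
exists C => x x0; have := HC x x0; rewrite ler_norml -/(dtrunc A K) => /andP[H _].
apply: (@le_trans _ _ (harm R (mults (trunc A K)) x)); last first.
  by apply: sub_harm => n _ _; apply: sub_mults; exact: trunc_sub.
have : (dsup A - e) * ln x%:R <= dtrunc A K * ln x%:R.
  by rewrite ler_wpM2r ?ln_nat_ge0 // ltW.
lra.
Qed.

Lemma log_densityE A : log_density R (multiples A) = lim (logavg R (mults A) @ \oo).
Proof.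
rewrite /log_density; congr (lim (_ @ \oo)); apply/funext => L.
rewrite /logavg /harm; congr (_ * _); apply: eq_bigl => l.
apply/idP/multsP => [/set_mem[a Aa [k _ ek]]|[a Aa /dvdnP[k ->]]].
  exists a => //; have := congr1 absz ek; rewrite abszM /= => <-.
  by rewrite dvdn_mulr.
by apply/mem_set; exists a => //; exists k%:Z => //; rewrite mulrC -PoszM.
Qed.

Lemma log_density_cvg A : A `<=` posN ->
  logavg R (mults A) @ \oo --> log_density R (multiples A).
Proof.
move=> Ap; rewrite log_densityE; have := davenport_erdos Ap => cv.
by rewrite (cvg_lim _ cv).
Qed.
End DavenportErdos.

(** * Behrend sets *)

Section Behrend.
Variable R : realType.
Implicit Types (S T : nat -> bool) (A B C : set nat) (e : R).

Definition lognull S := forall e, 0 < e -> ulog S e.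

Lemma lognull_sub S T : (forall n, (0 < n)%N -> S n -> T n) -> lognull T -> lognull S.
Proof. by move=> ST nT e e0; apply: ulog_sub ST _; exact: nT. Qed.

Lemma lognull0 : lognull xpred0.
Proof.
move=> e e0; exists 0 => x x0; rewrite addr0 /harm big_pred0_eq.
by rewrite mulr_ge0 ?ln_nat_ge0 // ltW.
Qed.

Lemma lognullU S T : lognull S -> lognull T -> lognull (fun n => S n || T n).
Proof.
move=> nS nT e e0; rewrite (splitr e).
by apply: ulogU; [apply: nS | apply: nT]; rewrite divr_gt0.
Qed.

Lemma ulog_has (I : eqType) (s : seq I) (F : I -> nat -> bool) e : 0 <= e ->
  (forall i, i \in s -> ulog (F i) e) ->
  ulog (fun n => has (fun i => F i n) s) ((size s)%:R * e).
Proof.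
move=> e0; elim: s => [|i s IHs] Fs.
  by exists 0 => x x0; rewrite mul0r addr0 mul0r /harm big_pred0_eq.
rewrite /= -natr1 mulrDl mul1r addrC; apply: ulogU; first exact: Fs (mem_head _ _).
by apply: IHs => j js; apply: Fs; rewrite inE js orbT.
Qed.

Lemma lognull_has (I : eqType) (s : seq I) (F : I -> nat -> bool) :
  (forall i, i \in s -> lognull (F i)) -> lognull (fun n => has (fun i => F i n) s).
Proof.
elim: s => [|i s IHs] Fs; first exact: lognull0.
apply: lognullU; first exact: Fs (mem_head _ _).
by apply: IHs => j js; apply: Fs; rewrite inE js orbT.
Qed.

Lemma lognull_comp S (g : nat -> nat) (c t0 : nat) : injective g ->
  (forall t, (0 < t)%N -> (0 < g t)%N) ->
  (forall t, (t0 <= t)%N -> (g t <= c * t)%N) ->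
  lognull S -> lognull (fun t => S (g t)).
Proof.
move=> gi g0 gc nS e e0.
have cR : 0 < c.+1%:R :> R by rewrite ltr0n.
rewrite -(divfK (lt0r_neq0 cR) e) mulrC; apply: (ulog_comp (t0 := t0)) => //.
  by move=> t tt; rewrite (leq_trans (gc t tt)) // leq_mul2r leqnSn orbT.
by apply: nS; rewrite divr_gt0.
Qed.

(** Dividing by a sends the multiples of a injectively to smaller numbers of
    larger inverse. *)
Lemma lognull_dilate S a : (0 < a)%N -> lognull S ->
  lognull (fun n => (a %| n)%N && S (n %/ a)%N).
Proof.
move=> a0 nS e e0; have [C HC] := nS e e0; exists C => x x0.
apply: le_trans (HC x x0); rewrite /harm.
rewrite -[leLHS]big_filter -[leRHS]big_filter.
set s := [seq n <- _ | (a %| n)%N && _].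
apply: (@le_trans _ _ (\sum_(n <- s) (n %/ a)%:R^-1)).
  rewrite big_seq [leRHS]big_seq; apply: ler_sum => n.
  rewrite mem_filter mem_index_iota => /andP[/andP[/dvdnP[k ->] _] /andP[]].
  rewrite mulnK // muln_gt0 => /andP[k0 _] _.
  by rewrite lef_pV2 ?posrE ?ltr0n ?muln_gt0 ?k0 // ler_nat leq_pmulr.
rewrite -(big_map (fun n => n %/ a)%N xpredT (fun l => l%:R^-1)).
apply: ler_sum_sub.
- rewrite map_inj_in_uniq ?filter_uniq ?iota_uniq // => m n.
  rewrite !mem_filter => /andP[/andP[am _] _] /andP[/andP[an _] _].
  by rewrite -{2}(divnK am) -{2}(divnK an) => ->.
- by rewrite filter_uniq ?iota_uniq.
- move=> l /mapP[n]; rewrite mem_filter mem_index_iota.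
  move=> /andP[/andP[/dvdnP[k ->] Sk] /andP[]]; rewrite mulnK // in Sk *.
  rewrite muln_gt0 => /andP[k0 _] kx ->; rewrite mem_filter mem_index_iota Sk k0.
  by rewrite (leq_ltn_trans _ kx) // leq_pmulr.
- by move=> l; rewrite invr_ge0.
Qed.

Lemma harmC S x : harm R (fun n => ~~ S n) x = harm R xpredT x - harm R S x.
Proof. by rewrite (harm_split R xpredT S) [X in X + _]/= addrAC subrr add0r. Qed.

Lemma behrendP A :
  behrend R A <-> A `<=` posN /\ lognull (fun n => ~~ mults A n).
Proof.
split=> -[Ap H]; split=> //.
  move=> e e0; have := @log_density_cvg R _ Ap; rewrite H => cv.
  have [C HC] := cvg_logavg_llog cv e0; exists (C + 1) => x x0.
  rewrite harmC; have := HC x x0; have := harmT_le R x0; lra.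
rewrite log_densityE; apply: cvg_lim => //; apply: cvg_logavg => e e0.
  exists 1 => x x0; have := harmT_le R x0.
  have : harm R (mults A) x <= harm R xpredT x by exact: sub_harm.
  have : 0 <= e * ln x%:R by rewrite mulr_ge0 ?ln_nat_ge0 // ltW.
  lra.
have [C HC] := H e e0; exists C => x x0; have := HC x x0; rewrite harmC.
have := harmT_ge R x0; lra.
Qed.

Lemma behrend_mults A B : (forall a, A a -> mults B a) -> B `<=` posN ->
  behrend R A -> behrend R B.
Proof.
move=> AB Bp /behrendP[_ nA]; apply/behrendP; split=> //.
apply: lognull_sub nA => n _; apply: contra => /multsP[a Aa an].
exact: mults_dvd an (AB a Aa).
Qed.

Lemma mults_gen A a : A a -> mults A a.
Proof. by move=> Aa; apply/multsP; exists a. Qed.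

Lemma behrend_sub A B : A `<=` B -> B `<=` posN -> behrend R A -> behrend R B.
Proof. by move=> AB; apply: behrend_mults => a /AB /mults_gen. Qed.

Lemma behrend_neq0 A : behrend R A -> A !=set0.
Proof.
move=> /behrendP[_ nA]; apply: contrapT => A0.
have h : (0 : R) < 1 / 2 by rewrite divr_gt0.
have : ulog xpredT (1 / 2 : R).
  apply: ulog_sub (nA _ h) => n _ _; apply/negP => /multsP[a Aa _].
  by apply: A0; exists a.
by move=> /ulogT; lra.
Qed.

Lemma behrend1 : behrend R [set 1%N].
Proof.
apply/behrendP; split; first by move=> _ ->.
apply: lognull_sub lognull0 => n _ /multsP[]; by exists 1%N.
Qed.

Lemma behrend_trunc A e : behrend R A -> 0 < e ->
  exists K, ulog (fun n => ~~ mults (trunc A K) n) e.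
Proof.
move=> /behrendP[Ap nA] e0; have e2 : 0 < e / 2 by rewrite divr_gt0.
have [K HK] := ulog_tail Ap e2; exists K; rewrite (splitr e).
apply: ulog_sub (ulogU (nA _ e2) HK) => n _ nt.
by case: (mults A n).
Qed.

Lemma coprime_period A u K : A `<=` posN -> (forall a, A a -> coprime a u) ->
  exists r, [/\ (0 < r)%N, coprime u r & forall a, trunc A K a -> (a %| r)%N].
Proof.
move=> Ap cop; exists (\prod_(1 <= a < K.+1 | coprime a u) a)%N; split.
- rewrite big_nat_cond; elim/big_ind: _ => // [m n m0 n0|i /andP[/andP[]]//].
  by rewrite muln_gt0 m0.
- elim/big_ind: _ => [|m n m0 n0|i]; rewrite ?coprimen1 ?coprimeMr ?m0 //.
  by rewrite coprime_sym.
- move=> a [Aa aK]; rewrite big_mkcond (bigD1_seq a) ?iota_uniq ?mem_index_iota //=.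
    by rewrite cop // dvdn_mulr.
  by rewrite ltnS aK andbT; exact: Ap.
Qed.

Lemma not_behrendP A : A `<=` posN -> ~ behrend R A ->
  exists2 e : R, 0 < e & ~ ulog (fun n => ~~ mults A n) e.
Proof.
move=> Ap nb; apply: contrapT => H; apply: nb; apply/behrendP; split => //.
by move=> e e0; apply: contrapT => nu; apply: H; exists e.
Qed.

(** A zero-one law.  Let F be the complement of M_(A_K), with Q = K!, and let T be
    a finite stage of the multiples of the elements of A coprime to Q.  The
    periods of F and T are coprime, so F and T are independent; but F and T meet
    inside M_A \ M_(A_K), which is small, while the density of F is bounded below
    because A is not Behrend.  Hence T is small. *)
Lemma not_behrend_coprime A e : A `<=` posN -> ~ behrend R A -> 0 < e ->
  exists2 Q, (0 < Q)%N & ulog (mults [set a | A a /\ coprime a Q]) e.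
Proof.
move=> Ap /(not_behrendP Ap)[e0 e0_gt0 ne0] e_gt0.
have e1_gt0 : 0 < e0 * (e / 2) by rewrite mulr_gt0 // divr_gt0.
have [K HK] := ulog_tail Ap e1_gt0.
exists K`!; first exact: fact_gt0.
set A' := [set a | _].
have A'p : A' `<=` posN by move=> a [/Ap].
have e2 : 0 < e / 2 by rewrite divr_gt0.
have [J HJ] := ulog_tail A'p e2.
have [r [r0 copr dr]] := @coprime_period A' K`! J A'p (fun a (H : A' a) => H.2).
pose F n := ~~ mults (trunc A K) n; pose T := mults (trunc A' J).
have pF : has_period K`! F by apply: has_periodN; exact: has_period_trunc.
have pT : has_period r T by exact: has_period_mults.
have fl : e0 < dens R F K`!.
  rewrite ltNge; apply/negP => fe; apply: ne0.
  apply: (@ulog_sub _ _ F) (ulog_le fe (ulog_periodic R (fact_gt0 K) pF)).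
  by move=> n _; apply: contra; apply: sub_mults; exact: trunc_sub.
have pFT : has_period (K`! * r) (fun n => F n && T n).
  by move=> n; rewrite {1}mulnC !periodicM.
have dFT : dens R (fun n => F n && T n) (K`! * r) = dens R F K`! * dens R T r.
  by rewrite /dens cnt_indep // !natrM mulf_div.
have : dens R (fun n => F n && T n) (K`! * r) <= e0 * (e / 2).
  apply: dens_le_ulog => //; first by rewrite muln_gt0 fact_gt0.
  apply: ulog_sub HK => n _ /andP[Fn Tn]; apply/andP; split; last exact: Fn.
  by move: Tn; apply: sub_mults => a [[]].
rewrite dFT => le1.
have dT : dens R T r <= e / 2.
  have := dens_ge0 R T r => d0.
  rewrite leNgt; apply/negP => lt; move: le1; rewrite leNgt => /negP; apply.
  apply: (@lt_le_trans _ _ (e0 * dens R T r)); first by rewrite ltr_pM2l.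
  by rewrite ler_wpM2r // ltW.
rewrite (splitr e).
apply: ulog_sub (ulogU (ulog_le dT (ulog_periodic R r0 pT)) HJ) => n _ ->.
by rewrite -/T; case: (T n).
Qed.

(** Divisibility by integers coprime to u cannot distinguish a progression of
    step u from the set of all integers. *)
Lemma mults_affine A u i e f : A `<=` posN -> (forall a, A a -> coprime a u) ->
  (0 < i)%N -> (0 < u)%N -> e < f -> ulog (mults A) e ->
  ulog (fun t => mults A (i + u * t)%N) f.
Proof.
move=> Ap cop i0 u0 ef uA.
have c0 : 0 < u.+1%:R :> R by rewrite ltr0n.
have d0 : 0 < (f - e) / u.+1%:R by rewrite divr_gt0 // subr_gt0.
have [K HK] := ulog_tail Ap d0.
have [r [r0 copr dr]] := @coprime_period A u K Ap cop.
have pT : has_period r (mults (trunc A K)) by exact: has_period_mults.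
have pTg : has_period r (fun t => mults (trunc A K) (i + u * t)%N).
  by move=> t; rewrite mulnDr addnA periodicM.
have dT : dens R (fun t => mults (trunc A K) (i + u * t)%N) r <= e.
  rewrite /dens cnt_affine // -/(dens R _ r); apply: dens_le_ulog => //.
  by apply: ulog_sub uA => n _; apply: sub_mults; exact: trunc_sub.
have g_inj : injective (fun t => i + u * t)%N.
  by move=> s t /addnI/eqP; rewrite eqn_pmul2l // => /eqP.
have := ulog_comp (t0 := i) (c := u.+1) g_inj _ _ HK.
rewrite mulrC divfK ?lt0r_neq0 // => /(_ _ _) H.
have {}H : ulog (fun t => mults A (i + u * t)%N && ~~ mults (trunc A K) (i + u * t)%N)
    (f - e).
  by apply: H => t; [rewrite addn_gt0 i0 | rewrite mulSn leq_add2r].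
have -> : f = e + (f - e) by rewrite addrCA subrr addr0.
apply: ulog_sub (ulogU (ulog_le dT (ulog_periodic R r0 pTg)) H) => n _ ->.
by case: (mults (trunc A K) _).
Qed.

(** If neither set is Behrend, choose Q as in [not_behrend_coprime] for both: on
    the progression 1 + Q t only elements coprime to Q can divide, and they leave
    most of it free. *)
Lemma behrendU A B : A `<=` posN -> B `<=` posN ->
  behrend R (A `|` B) -> behrend R A \/ behrend R B.
Proof.
move=> Ap Bp /behrendP[_ nAB]; apply: contrapT => /not_orP[nA nB].
have q : (0 : R) < 1 / 8 by rewrite divr_gt0.
have [Q1 Q10 u1] := not_behrend_coprime Ap nA q.
have [Q2 Q20 u2] := not_behrend_coprime Bp nB q.
pose Q := (Q1 * Q2)%N; have Q0 : (0 < Q)%N by rewrite muln_gt0 Q10.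
have key D Q' : D `<=` posN -> (Q' %| Q)%N -> 
    ulog (mults [set a | D a /\ coprime a Q']) (1 / 8 : R) ->
    ulog (fun t => mults [set a | D a /\ coprime a Q] (1 + Q * t)%N) (1 / 4 : R).
  move=> Dp dQ uD; apply: (@mults_affine _ _ _ (1 / 8)) => //.
  - by move=> a [/Dp].
  - by move=> a [].
  - by lra.
  - apply: ulog_sub uD => n _; apply: sub_mults => a [Da ca]; split => //.
    exact: coprime_dvdr dQ ca.
have v1 := key A Q1 Ap (dvdn_mulr _ (dvdnn _)) u1.
have v2 := key B Q2 Bp (dvdn_mull _ (dvdnn _)) u2.
have g_inj : injective (fun t => 1 + Q * t)%N.
  by move=> s t /addnI/eqP; rewrite eqn_pmul2l // => /eqP.
have v3 : ulog (fun t => ~~ mults (A `|` B) (1 + Q * t)%N) (1 / 4 : R).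
  have q4 : (0 : R) < 1 / 4 by rewrite divr_gt0.
  apply: (lognull_comp (t0 := 1) (c := Q.+1) g_inj _ _ nAB) q4 => // t t1.
  by rewrite mulSn leq_add2r.
have : ulog xpredT (1 / 4 + 1 / 4 + 1 / 4 : R).
  apply: ulog_sub (ulogU (ulogU v1 v2) v3) => t _ _.
  case: (boolP (mults (A `|` B) _)) => [/multsP[a AB an]|]; rewrite ?orbT // orbF.
  have ca : coprime a Q.
    apply: (coprime_dvdl an); rewrite /coprime mulnC addnC gcdnC.
    by rewrite gcdnMDl gcdn1.
  by case: AB => Da; apply/orP; [left|right]; apply/multsP; exists a.
by move=> /ulogT; lra.
Qed.

Lemma behrend_bigU (s : seq nat) (F : nat -> set nat) :
  (forall i, F i `<=` posN) ->
  behrend R [set a | exists2 i, i \in s & F i a] ->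
  exists2 i, i \in s & behrend R (F i).
Proof.
move=> Fp; elim: s => [/behrend_neq0[a [i]]//|i s IHs].
have -> : [set a | exists2 j, j \in i :: s & F j a] =
          F i `|` [set a | exists2 j, j \in s & F j a].
  apply/seteqP; split=> a; last first.
    by case=> [Fa|[j js Fa]]; [exists i; rewrite ?mem_head | exists j; rewrite // inE js orbT].
  by move=> [j]; rewrite inE => /orP[/eqP -> Fa|js Fa]; [left | right; exists j].
move=> /behrendU[//||bF|/IHs[j js bF]].
- by move=> a [j _ /Fp].
- by exists i; rewrite ?mem_head.
- by exists j; rewrite // inE js orbT.
Qed.
End Behrend.

(** * Taut sets and the tautification *)

Section Taut.
Variable R : realType.
Implicit Types (S T : nat -> bool) (A B C : set nat) (e : R).
Local Notation lognull := (@lognull R).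
Local Notation delta A := (log_density R (multiples A)).

Lemma log_density_le A B : A `<=` posN -> B `<=` posN ->
  lognull (fun n => mults A n && ~~ mults B n) -> delta A <= delta B.
Proof.
move=> Ap Bp nAB; have cA := @log_density_cvg R _ Ap; have cB := @log_density_cvg R _ Bp.
rewrite -subr_le0 leNgt; apply/negP => lt0.
set d := _ - _ in lt0; have d4 : 0 < d / 4 by rewrite divr_gt0.
have [C1 H1] := cvg_logavg_llog cA d4; have [C2 H2] := cvg_logavg_ulog cB d4.
have [C3 H3] := nAB _ d4.
suff : d / 4 <= 0 by rewrite leNgt d4.
apply: (@ln_bounded_le0 _ _ (C1 + C2 + C3)) => x x0.
have := H1 x x0; have := H2 x x0; have := H3 x x0.
have : harm R (mults A) x <= harm R (mults B) x + harm R (fun n => mults A n && ~~ mults B n) x.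
  apply: le_trans (harmU _ _ _ _); apply: sub_harm => n _ _ ->.
  by case: (mults B n).
rewrite /d; lra.
Qed.

Lemma log_density_null A B : A `<=` posN -> B `<=` A -> delta A <= delta B ->
  lognull (fun n => mults A n && ~~ mults B n).
Proof.
move=> Ap BA dAB e e0; have Bp : B `<=` posN by apply: subset_trans Ap.
have cA := @log_density_cvg R _ Ap; have cB := @log_density_cvg R _ Bp.
have e2 : 0 < e / 2 by rewrite divr_gt0.
have [C1 H1] := cvg_logavg_ulog cA e2; have [C2 H2] := cvg_logavg_llog cB e2.
exists (C1 + C2) => x x0; have := H1 x x0; have := H2 x x0.
rewrite (harm_split R (mults A) (mults B)).
have -> : harm R (fun n => mults A n && mults B n) x = harm R (mults B) x.
  apply/eqP; rewrite eq_le !sub_harm // => n _ _; last by case/andP.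
  by move=> Bn; rewrite Bn andbT; exact: sub_mults Bn.
have : delta A * ln x%:R <= delta B * ln x%:R by rewrite ler_wpM2r ?ln_nat_ge0.
lra.
Qed.

(** For a primitive set C this says that the only dilates of Behrend sets inside C
    are singletons, which characterizes tautness ([taut_behrend_closed],
    [behrend_closed_taut]). *)
Definition behrend_closed C := forall a A, behrend R A -> (0 < a)%N ->
  (forall x, A x -> C (a * x)%N) -> C a.

Definition primitive C := forall a b, C a -> C b -> (b %| a)%N -> b = a.

Lemma not_behrend_set1 a : (1 < a)%N -> ~ behrend R [set a].
Proof.
move=> a1 /behrendP[_ na]; have a0 := ltnW a1.
have p : has_period a (fun n => ~~ mults [set a] n).
  by apply: has_periodN; apply: has_period_mults => _ ->.
have d0 : 0 < dens R (fun n => ~~ mults [set a] n) a.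
  rewrite divr_gt0 ?ltr0n // /cnt (bigD1_seq 1%N) ?iota_uniq ?mem_index_iota //=.
  case: multsP => // -[_ ->]; rewrite dvdn1 => /eqP a_1.
  by rewrite a_1 in a1.
have := dens_le_ulog a0 p (na _ (_ : 0 < dens R (fun n => ~~ mults [set a] n) a / 2)).
by rewrite divr_gt0 // => /(_ isT); lra.
Qed.

(** If a A is contained in C with A Behrend and 1 not in A, remove some b from A.
    The rest of A is still Behrend, so removing a b from C only loses a null set
    of multiples. *)
Lemma taut_behrend_closed C : taut R C -> behrend_closed C.
Proof.
move=> [Cp tC] a A bA a0 AC; have [Ap _] := (behrendP R A).1 bA.
have [A1|nA1] := EM (A 1%N); first by rewrite -(muln1 a); exact: AC.
have [b Ab] := behrend_neq0 bA; have b1 : (1 < b)%N.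
  rewrite ltn_neqAle; have b0 := Ap _ Ab; rewrite b0 andbT.
  by apply/eqP => b1; apply: nA1; rewrite b1.
have /behrendP[_ nA'] : behrend R (A `\ b).
  have [|||//|/(not_behrend_set1 b1)//] := @behrendU R (A `\ b) [set b].
  - by move=> x [/Ap].
  - by move=> _ ->; exact: Ap.
  - apply: behrend_sub bA; last by move=> x [[/Ap]//|->]; exact: Ap.
    by move=> x Ax; have [->|xb] := eqVneq x b; [right | left; split => // /eqP; exact/negP].
have := tC _ (AC _ Ab); rewrite ltNge => /negP[].
apply: log_density_le => //; first by move=> x [/Cp].
apply: lognull_sub (lognull_dilate a0 nA') => n _ /andP[/multsP[c Cc cn] nC'].
have cE : c = (a * b)%N.
  apply: contrapT => cab; move/negP: nC'; apply; apply/multsP; exists c => //.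
have an : (a %| n)%N by apply: dvdn_trans cn; rewrite cE dvdn_mulr.
rewrite an /=; apply: contra nC' => /multsP[x [Ax xb] xn]; apply/multsP.
exists (a * x)%N; last by rewrite -(divnK an) mulnC dvdn_pmul2r // .
split; first exact: AC.
move=> /eqP; rewrite eqn_pmul2l // => /eqP; exact: xb.
Qed.

(** The multiples of a that are lost with a are the a t with t free of the sets
    {x | d x in C, d x <> a}, for d dividing a.  If they were null, one of these
    finitely many sets would be Behrend, so d would lie in C, whence d = a by
    primitivity; but then d x in C contradicts primitivity. *)
Lemma behrend_closed_taut C : C `<=` posN -> behrend_closed C -> primitive C -> taut R C.
Proof.
move=> Cp clC prC; split => // a Ca; rewrite ltNge; apply/negP => le.
have a0 : (0 < a)%N := Cp _ Ca.
have nS := log_density_null Cp (@subDsetl _ C [set a]) le.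
pose F (d : nat) : set nat := [set x | [/\ (0 < x)%N, C (d * x)%N & (d * x)%N <> a]].
have [||d] := @behrend_bigU R (divisors a) F; first by move=> d x [].
  apply/behrendP; split; first by move=> x [d _ []].
  have g_inj : injective (muln a) by move=> s t /eqP; rewrite eqn_pmul2l // => /eqP.
  have := lognull_comp (t0 := 0) (c := a) g_inj _ _ nS.
  move=> /(_ _ _)/(_ _ _) H; apply: lognull_sub (H _ _).
  - move=> t t0 nt; apply/andP; split.
      by apply/multsP; exists a => //; rewrite dvdn_mulr.
    apply: contra nt => /multsP[b [Cb ba] bt].
    pose d := gcdn b a; have d0 : (0 < d)%N by rewrite gcdn_gt0 a0 orbT.
    have eb : (d %| b)%N by exact: dvdn_gcdl.
    have ea : (d %| a)%N by exact: dvdn_gcdr.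
    apply/multsP; exists (b %/ d)%N.
      exists d; first by rewrite -dvdn_divisors.
      rewrite /F /= mulnC divnK //; split => //.
      by rewrite divn_gt0 // dvdn_leq //; exact: Cp.
    have cop : coprime (b %/ d) (a %/ d).
      by rewrite /coprime -(eqn_pmul2r d0) mul1n muln_gcdl !divnK.
    rewrite -(Gauss_dvdr t cop) -(dvdn_pmul2r d0) divnK // mulnAC divnK //.
  - by move=> t t0; rewrite muln_gt0 a0.
  - by [].
rewrite -dvdn_divisors // => ea bF.
have d0 : (0 < d)%N := dvdn_gt0 a0 ea.
have Ce : C d by apply: (clC d _ bF d0) => x [].
have ee := prC _ _ Ca Ce ea; have [x [x0 Cx]] := behrend_neq0 bF.
by apply; rewrite ee in Cx *; apply/esym/prC => //; rewrite dvdn_mulr.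
Qed.

Lemma prim_below (D : set nat) d : D `<=` posN -> D d -> exists2 c, prim D c & (c %| d)%N.
Proof.
move=> Dp; elim/ltn_ind: d => d IHd Dd.
have [pd|npd] := EM (prim D d); first by exists d.
have [b [Db bd bdd]] : exists b, [/\ D b, b != d & (b %| d)%N].
  apply: contrapT => H; apply: npd; split => // b Db bd; apply/negP => bdd.
  by apply: H; exists b.
have lt : (b < d)%N by rewrite ltn_neqAle bd dvdn_leq //; exact: Dp.
by have [c pc cb] := IHd b lt Db; exists c => //; exact: dvdn_trans bdd.
Qed.

Lemma prim_primitive D : primitive (prim D).
Proof.
move=> a b [_ pa] [Db _] ba; apply/eqP; apply: contraT => nba.
by have := pa b Db nba; rewrite ba.
Qed.

Variables (B : set nat) (hB : B `<=` posN).
Local Notation B' := (tautification R B).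

Lemma sub_behrend_factors : B `<=` behrend_factors R B.
Proof.
move=> b Bb; split; first exact: hB.
exists [set 1%N]; first exact: behrend1.
by move=> _ [_ -> <-]; rewrite muln1.
Qed.

Lemma tautification_posN : B' `<=` posN.
Proof. by move=> a [[/hB//|[]]]. Qed.

Lemma tautification_factor a : B' a ->
  exists2 A, behrend R A & forall x, A x -> B (a * x)%N.
Proof.
move=> [BC _]; have [_ [A bA AB]] : behrend_factors R B a.
  by case: BC => // /sub_behrend_factors.
by exists A => // x Ax; apply: AB; exists x.
Qed.

Lemma mults_tautification a A : (0 < a)%N -> behrend R A ->
  (forall x, A x -> B (a * x)%N) -> mults B' a.
Proof.
move=> a0 bA AB.
have [||c pc ca] := @prim_below (B `|` behrend_factors R B) a.
- by move=> x [/hB//|[]].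
- by right; split => //; exists A => // _ [x Ax <-]; exact: AB.
- by apply/multsP; exists c.
Qed.

Lemma sub_mults_tautification n : mults B n -> mults B' n.
Proof.
move=> /multsP[b Bb bn]; apply: (mults_dvd bn).
apply: (@mults_tautification _ [set 1%N]); first exact: hB.
  exact: behrend1.
by move=> _ ->; rewrite muln1.
Qed.

(** Being a Behrend factor is transitive: if a A is contained in B' and each a x,
    for x in A, has a Behrend set A_x with a x A_x in B, then the union of the
    sets x A_x is Behrend. *)
Lemma tautification_closed : behrend_closed B'.
Proof.
move=> a A bA a0 AB'.
pose D := [set d | (0 < d)%N /\ B (a * d)%N].
have bD : behrend R D.
  apply/behrendP; split; first by move=> x [].
  move=> e e0; have e2 : 0 < e / 2 by rewrite divr_gt0.
  have [K HK] := behrend_trunc bA e2; have [Ap _] := (behrendP R A).1 bA.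
  pose F x n := (`[< trunc A K x >] && (x %| n)%N) && ~~ mults D n.
  have nF : lognull (fun n => has (fun x => F x n) (iota 0 K.+1)).
    apply: lognull_has => x _.
    have [[Ax xK]|nx] := EM (trunc A K x); last first.
      by apply: lognull_sub (@lognull0 R) => n _ /andP[/andP[/asboolP]].
    have x0 : (0 < x)%N by exact: Ap.
    have [E bE EB] := tautification_factor (AB' _ Ax).
    have [Ep nE] := (behrendP R E).1 bE.
    apply: lognull_sub (lognull_dilate x0 nE) => n _ /andP[/andP[_ xn] nD].
    rewrite xn /=; apply: contra nD => /multsP[y Ey yn]; apply/multsP.
    exists (x * y)%N; last by rewrite -(divnK xn) mulnC dvdn_pmul2r.
    split; first by rewrite muln_gt0 x0; exact: Ep.
    by rewrite mulnA; exact: EB.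
  rewrite (splitr e); apply: ulog_sub (ulogU HK (nF _ e2)) => n _ nD.
  have [|//] := boolP (mults (trunc A K) n) => /multsP[x tx xn].
  apply/orP; right; apply/hasP; exists x.
    by rewrite mem_iota add0n ltnS; case: tx.
  by rewrite /F xn nD !andbT; apply/asboolP.
have /multsP[c Bc ca] : mults B' a by apply: (mults_tautification a0 bD) => x [].
have [x Ax] := behrend_neq0 bA.
have cE := prim_primitive (AB' _ Ax) Bc (dvdn_mulr x ca).
have ac : (a %| c)%N by rewrite cE dvdn_mulr.
suff -> : a = c by [].
by apply/eqP; rewrite eqn_dvd ac ca.
Qed.

Lemma tautification_taut : taut R B'.
Proof.
apply: behrend_closed_taut; [exact: tautification_posN | exact: tautification_closed|].
exact: prim_primitive.
Qed.
End Taut.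

(** * Windows free of multiples *)

Lemma coprime_no_prime m n : (0 < n)%N ->
  (forall p, prime p -> (p %| m)%N -> (p %| n)%N -> False) -> coprime m n.
Proof.
move=> n0 H; rewrite /coprime; apply: contraT => g1.
have g0 : (0 < gcdn m n)%N by rewrite gcdn_gt0 n0 orbT.
have g2 : (1 < gcdn m n)%N by rewrite ltn_neqAle eq_sym g1.
case: (H (pdiv (gcdn m n))); first exact: pdiv_prime.
  by apply: dvdn_trans (pdiv_dvd _) (dvdn_gcdl _ _).
by apply: dvdn_trans (pdiv_dvd _) (dvdn_gcdr _ _).
Qed.

Lemma gcdn_eqmod a b L : (a = b %[mod L])%N -> gcdn a L = gcdn b L.
Proof. by move=> e; rewrite -gcdn_modl e gcdn_modl. Qed.

Lemma gcd_cofactor_coprime x L : (0 < L)%N ->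
  (forall p, prime p -> (p %| L)%N -> (p %| L %/ gcdn x L)%N) ->
  coprime (x %/ gcdn x L) L.
Proof.
move=> L0 H; apply: coprime_no_prime => // p pp py pL.
have g0 : (0 < gcdn x L)%N by rewrite gcdn_gt0 L0 orbT.
have : (p * gcdn x L %| gcdn x L)%N.
  rewrite dvdn_gcd -[X in (_ %| X)%N && _](divnK (dvdn_gcdl x L)).
  by rewrite -[X in _ && (_ %| X)%N](divnK (dvdn_gcdr x L)) !dvdn_pmul2r // py H.
rewrite -{2}[gcdn x L]mul1n dvdn_pmul2r // dvdn1 => /eqP p1.
by rewrite p1 in pp.
Qed.

Section Windows.
Variable R : realType.
Implicit Types (C : set nat) (e : R).

(** See the introduction.  The positions are k0 + j, for j in M, in a window of
    length W + 1.  The second hypothesis on primes says that the cofactors of the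
    gcds are coprime to L ([gcd_cofactor_coprime]), so that elements of C not
    coprime to L obstruct only through the gcds; primes up to W + 1 must divide L
    because such a prime divides one of any W + 1 consecutive integers. *)
Lemma free_window C (M : seq nat) W k0 L e : C `<=` posN -> behrend_closed R C ->
  (0 < L)%N -> (forall j, j \in M -> (j <= W)%N) ->
  (forall p, prime p -> (p <= W.+1)%N -> (p %| L)%N) ->
  (forall j, j \in M -> ~~ mults C (gcdn (k0 + j) L)) ->
  (forall j, j \in M -> forall p, prime p -> (p %| L)%N ->
     (p %| L %/ gcdn (k0 + j) L)%N) ->
  0 < e ->
  exists u k1, [/\ (0 < u)%N, (0 < k1)%N, (L %| u)%N, (k1 = k0 %[mod L])%N &
    ulog (fun t => has (fun j => mults C (k1 + u * t + j)) M) e].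
Proof.
move=> Cp clC L0 MW small H1 H2 e0.
pose s := flatten [seq divisors (gcdn (k0 + j) L) | j <- M].
have sP d : reflect (exists2 j, j \in M & (d %| gcdn (k0 + j) L)%N) (d \in s).
  apply: (iffP flatten_mapP) => -[j jM dj]; exists j => //.
    by rewrite dvdn_divisors // gcdn_gt0 L0 orbT.
  by rewrite -dvdn_divisors // gcdn_gt0 L0 orbT.
pose F d : set nat := [set a | (0 < a)%N /\ C (d * a)%N].
pose A : set nat := [set a | exists2 d, d \in s & F d a].
have Ap : A `<=` posN by move=> a [d _ []].
have nA : ~ behrend R A.
  move=> /behrend_bigU[|d /sP[j jM dj] bF]; first by move=> d a [].
  have d0 : (0 < d)%N by apply: dvdn_gt0 dj; rewrite gcdn_gt0 L0 orbT.
  have Cd : C d by apply: (clC _ _ bF d0) => a [].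
  by have /negP := H1 j jM; apply; apply/multsP; exists d.
have m0 : 0 < (size M).+1%:R :> R by rewrite ltr0n.
pose f := e / (size M).+1%:R; have f0 : 0 < f by rewrite divr_gt0.
have f2 : 0 < f / 2 by rewrite divr_gt0.
have [Q Q0 uQ] := not_behrend_coprime Ap nA f2.
(* Q' is the part of Q coprime to L; modulo Q' the positions are 1 + j, hence
   coprime to Q' because the primes dividing Q' exceed W + 1. *)
pose Q' := (Q`_(\pi(L)^'))%N; have Q'0 : (0 < Q')%N by rewrite part_gt0.
have copLQ : coprime L Q' by rewrite coprime_pi' // part_pnat.
pose k1 := (chinese L Q' k0 1 + L * Q')%N; pose u := (L * Q')%N.
have u0 : (0 < u)%N by rewrite muln_gt0 L0.
have k1L : (k1 = k0 %[mod L])%N.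
  by rewrite /k1 addnC mulnC modnMDl chinese_modl.
have k1Q : (k1 = 1 %[mod Q'])%N.
  by rewrite /k1 addnC modnMDl chinese_modr.
exists u, k1; split => //.
- by rewrite addn_gt0 u0 orbT.
- by rewrite dvdn_mulr.
pose A' : set nat := [set a | A a /\ coprime a u].
have A'p : A' `<=` posN by move=> a [/Ap].
have copuQ a : (0 < a)%N -> coprime a u -> coprime a Q.
  move=> a0; rewrite coprimeMr => /andP[aL aQ']; rewrite -(partnC \pi(L) Q0) coprimeMr aQ' andbT.
  rewrite coprime_sym; apply: pnat_coprime (part_pnat _ _) _.
  by move: aL; rewrite coprime_sym coprime_pi'.
have uA' : ulog (mults A') (f / 2).
  by apply: ulog_sub uQ => n _; apply: sub_mults => a [Aa /(copuQ _ (Ap _ Aa))].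
have key j : j \in M -> ulog (fun t => mults C (k1 + u * t + j)) f.
  move=> jM; have lt : f / 2 < f by move: f0; lra.
  have k1j : (0 < k1 + j)%N by rewrite !addn_gt0 u0 orbT.
  have := mults_affine A'p (fun a (H : A' a) => H.2) k1j u0 lt uA'.
  apply: ulog_sub => t _; rewrite [X in mults A' X]addnAC; set x := (k1 + u * t + j)%N.
  move=> /multsP[c Cc cx].
  have xk0 : (x = k0 + j %[mod L])%N.
    have -> : x = (Q' * t * L + (k1 + j))%N by rewrite /x /u; ring.
    by rewrite modnMDl -(modnDml k1) k1L modnDml.
  have xj : (x = 1 + j %[mod Q'])%N.
    have -> : x = (L * t * Q' + (k1 + j))%N by rewrite /x /u; ring.
    by rewrite modnMDl -(modnDml k1) k1Q modnDml.
  set d0 := gcdn (k0 + j) L.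
  have d0E : gcdn x L = d0 by exact: gcdn_eqmod.
  have d00 : (0 < d0)%N by rewrite gcdn_gt0 L0 orbT.
  have d0x : (d0 %| x)%N by rewrite -d0E dvdn_gcdl.
  pose y := (x %/ d0)%N; have xE : x = (y * d0)%N by rewrite divnK.
  have yL : coprime y L.
    rewrite /y -d0E; apply: gcd_cofactor_coprime => // p pp pL.
    by rewrite d0E; exact: H2.
  have yQ : coprime y Q'.
    apply: coprime_no_prime => // p pp py pQ.
    have px : (p %| x)%N by rewrite xE dvdn_mulr.
    have pj : (p %| j.+1)%N.
      by rewrite -add1n /dvdn -(modn_dvdm (1 + j) pQ) -xj modn_dvdm.
    have pW : (p <= W.+1)%N by apply: leq_trans (dvdn_leq _ pj) _ => //; exact: MW.
    have := coprime_dvdl (small p pp pW) (coprime_dvdr pQ copLQ).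
    by rewrite /coprime gcdnn => /eqP p1; rewrite p1 in pp.
  pose d := gcdn c d0; have dc : (d %| c)%N by exact: dvdn_gcdl.
  have dd0 : (d %| d0)%N by exact: dvdn_gcdr.
  have dgt0 : (0 < d)%N by rewrite gcdn_gt0 d00 orbT.
  have ay : (c %/ d %| y)%N.
    have cop : coprime (c %/ d) (d0 %/ d).
      by rewrite /coprime -(eqn_pmul2r dgt0) mul1n muln_gcdl !divnK.
    rewrite -(Gauss_dvdl y cop) -(dvdn_pmul2r dgt0) -mulnA (divnK dd0) (divnK dc).
    by rewrite -xE.
  apply/multsP; exists (c %/ d)%N; last by apply: (dvdn_trans ay); rewrite xE dvdn_mulr.
  split; last by rewrite coprimeMr !(coprime_dvdl ay).
  exists d; first by apply/sP; exists j.
  split; first by rewrite divn_gt0 // dvdn_leq //; exact: Cp.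
  by rewrite mulnC divnK.
apply: ulog_le (ulog_has (ltW f0) key).
by rewrite /f mulrCA ler_piMr ?ltW // ltr_pdivrMr // mul1r ltr_nat.
Qed.
End Windows.

Lemma dvdn_eqmod d L a b : (d %| L)%N -> (a = b %[mod L])%N -> (d %| a)%N = (d %| b)%N.
Proof. by move=> dL e; rewrite /dvdn -(modn_dvdm a dL) e modn_dvdm. Qed.

(** * Blocks around the origin *)

(** The window [-N, N] is indexed by j = 0, ..., 2 N through m = j - N. *)
Definition zeros C N := [seq j <- iota 0 (2 * N).+1 | mults C `|j%:Z - N%:Z|%N].
Definition ones C N := [seq j <- iota 0 (2 * N).+1 | ~~ mults C `|j%:Z - N%:Z|%N].

Section Patterns.
Variable R : realType.
Implicit Types (B C : set nat) (e : R).

(** The case of [free_window] in which the window sits around 0: with L divisible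
    by (2 N + 1)!^2, the gcd of L with L + m is |m| for m <> 0. *)
Lemma free_pattern C N e : C `<=` posN -> behrend_closed R C -> 0 < e ->
  exists u k, [/\ (0 < u)%N, (0 < k)%N,
    forall j, j \in zeros C N -> exists2 c, C c & forall t, (c %| k + u * t + j)%N &
    ulog (fun t => has (fun j => mults C (k + u * t + j)) (ones C N)) e].
Proof.
move=> Cp clC e0.
have [[c0 Cc0]|C0] := EM (exists c, C c); last first.
  have mC n : mults C n = false by apply/negbTE/negP => /multsP[c Cc _]; apply: C0; exists c.
  exists 1%N, 1%N; split => //.
    by move=> j; rewrite mem_filter mC.
  have : ulog xpred0 e by exact: lognull0.
  by apply: ulog_sub => n _ /hasP[j _]; rewrite mC.
have c00 : (0 < c0)%N by exact: Cp.
pose W := (2 * N)%N; pose P := (W.+1)`!; pose L := (P * P * c0)%N.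
have P0 : (0 < P)%N by exact: fact_gt0.
have L0 : (0 < L)%N by rewrite /L 2!muln_gt0 P0.
have NL : (N <= L)%N.
  apply: (@leq_trans P); first by apply: leq_trans (fact_geq _); rewrite /W; lia.
  by rewrite /L -mulnA leq_pmulr // muln_gt0 P0.
have distL j : (j <= W)%N -> j != N -> (`|j%:Z - N%:Z|%N %| P)%N.
  by move=> jW jN; apply: dvdn_fact; rewrite /W in jW *; lia.
have PL : (P %| L)%N by rewrite /L -mulnA dvdn_mulr.
have shift j : (j <= W)%N -> j != N -> gcdn (L - N + j) L = `|j%:Z - N%:Z|%N.
  move=> jW jN; have dL := dvdn_trans (distL j jW jN) PL.
  set m := `|_|%N in dL *; apply/eqP; rewrite eqn_dvd dvdn_gcd dL andbT.
  have hg := dvdn_gcdl (L - N + j) L; have hL := dvdn_gcdr (L - N + j) L.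
  have [le|lt] := leqP N j.
    have E : (L - N + j = L + m)%N by rewrite /m; lia.
    by rewrite E in hg hL *; rewrite dvdn_addr // dvdnn andbT -(dvdn_addr m hL).
  have E : (L - N + j + m = L)%N by rewrite /m; lia.
  have mE : (m %| L - N + j)%N by rewrite -(dvdn_addl _ (dvdnn m)) E.
  by rewrite mE andbT -(dvdn_addr _ hg) E.
have onesP j : j \in ones C N -> [/\ (j <= W)%N, j != N & ~~ mults C `|j%:Z - N%:Z|%N].
  rewrite mem_filter mem_iota => /andP[h jW]; split => //.
  apply: contraNneq h => ->; rewrite subrr; apply/multsP; by exists c0.
have [|||||u [k [u0 k0 Lu kL uk]]] :=
  @free_window R C (ones C N) W (L - N) L e Cp clC L0.
- by move=> j /onesP[].
- move=> p pp pW; apply: dvdn_trans PL; apply: dvdn_fact.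
  by rewrite prime_gt0.
- by move=> j /onesP[jW jN h]; rewrite shift.
- move=> j /onesP[jW jN h] p pp; rewrite shift //.
  have dP := distL j jW jN; have d0 : (0 < `|j%:Z - N%:Z|)%N by lia.
  move=> pL; have -> : (L %/ `|j%:Z - N%:Z| = P %/ `|j%:Z - N%:Z| * (P * c0))%N.
    by rewrite /L -mulnA -{1}(divnK dP) mulnAC mulnK.
  move: pL; rewrite /L -mulnA Euclid_dvdM // => /orP[pP|pc]; rewrite dvdn_mull //.
  by rewrite dvdn_mulr.
- by [].
exists u, k; split => // j; rewrite mem_filter mem_iota => /andP[mj jW].
have [c [Cc cL ck]] : exists c, [/\ C c, (c %| L)%N & (c %| L - N + j)%N].
  have [jN|jN] := eqVneq j N.
    by exists c0; rewrite jN subnK // /L !dvdn_mull.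
  have /multsP[c Cc cm] := mj; exists c; rewrite -(shift j) // in cm.
  by rewrite dvdn_gcd in cm; case/andP: cm.
exists c => // t; rewrite -(dvdn_eqmod cL (_ : L - N + j = _ %[mod L])%N) //.
have /dvdnP[v ->] := Lu.
have -> : (k + v * L * t + j = v * t * L + (k + j))%N by ring.
by rewrite modnMDl -(modnDml k) kL modnDml.
Qed.
End Patterns.

(** * Blocks of the tautification *)

Section TautificationPatterns.
Variable R : realType.
Variables (B : set nat) (hB : B `<=` posN).
Implicit Types (C : set nat) (e : R).
Local Notation B' := (tautification R B).
Local Notation lognull := (@lognull R).

Lemma addMn_inj i u : (0 < u)%N -> injective (fun t => i + u * t)%N.
Proof. by move=> u0 s t /addnI/eqP; rewrite eqn_pmul2l // => /eqP. Qed.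

Lemma onesE C N j : (j \in ones C N) = (j <= 2 * N)%N && ~~ mults C `|j%:Z - N%:Z|%N.
Proof. by rewrite mem_filter mem_iota add0n ltnS andbC. Qed.

Lemma zerosE C N j : (j \in zeros C N) = (j <= 2 * N)%N && mults C `|j%:Z - N%:Z|%N.
Proof. by rewrite mem_filter mem_iota add0n ltnS andbC. Qed.

(** For c in B' there is a Behrend set A with c A in B, and almost every n is a
    multiple of an element of A. *)
Lemma factor_null c : B' c -> lognull (fun n => (c %| n)%N && ~~ mults B n).
Proof.
move=> B'c; have c0 : (0 < c)%N := tautification_posN hB B'c.
have [A bA AB] := tautification_factor hB B'c.
have [Ap nA] := (behrendP R A).1 bA.
apply: lognull_sub (lognull_dilate c0 nA) => n _ /andP[cn nB].
rewrite cn /=; apply: contra nB => /multsP[x Ax xn]; apply/multsP.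
exists (c * x)%N; first exact: AB.
by rewrite -(divnK cn) mulnC dvdn_pmul2r.
Qed.

Lemma pattern_tautification N :
  exists k : nat, forall j, (j <= 2 * N)%N ->
    mults B' `|j%:Z - N%:Z|%N = mults B (k + j).
Proof.
have q : (0 : R) < 1 / 4 by rewrite divr_gt0.
have [u [k [u0 k0 zP oP]]] :=
  free_pattern N (tautification_posN hB) (tautification_closed hB) q.
have zn : ulog (fun t => has (fun j => ~~ mults B (k + u * t + j)) (zeros B' N)) (1 / 4 : R).
  apply: lognull_has q => j jz; have [c B'c ck] := zP j jz.
  have H := factor_null B'c.
  have g0 : (0 < k + j)%N by rewrite addn_gt0 k0.
  have := lognull_comp (t0 := k + j) (c := u.+1) (@addMn_inj (k + j) _ u0) _ _ H.
  have h1 t : (0 < t -> 0 < k + j + u * t)%N by rewrite addn_gt0 g0.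
  have h2 t : (k + j <= t -> k + j + u * t <= u.+1 * t)%N by rewrite mulSn leq_add2r.
  move=> /(_ h1 h2); apply: lognull_sub => t _ nB.
  by rewrite addnAC ck.
have lt1 : 1 / 4 + 1 / 4 < (1 : R) by lra.
have [t t0] := ulog_exists lt1 (ulogU oP zn).
rewrite negb_or => /andP[/hasPn ot /hasPn zt].
exists (k + u * t)%N => j jN.
have [mj|nmj] := boolP (mults B' `|j%:Z - N%:Z|%N).
  by have := zt j; rewrite zerosE jN mj negbK => /(_ isT) ->.
have := ot j; rewrite onesE jN nmj => /(_ isT) h.
by apply/esym/negbTE; apply: contra h; exact: sub_mults_tautification.
Qed.

(** The exceptional set of multiples of B'_K that are not multiples of B, made
    periodic by truncating B at a large J. *)
Lemma uniform_trunc K e : 0 < e -> exists J,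
  ulog (fun n => mults (trunc B' K) n && ~~ mults (trunc B J) n) e.
Proof.
move=> e0; have e2 : 0 < e / 2 by rewrite divr_gt0.
have [J HJ] := ulog_tail hB e2; exists J.
pose F c n := `[< trunc B' K c >] && ((c %| n)%N && ~~ mults B n).
have nF : lognull (fun n => has (fun c => F c n) (iota 0 K.+1)).
  apply: lognull_has => c _.
  have [[B'c cK]|nc] := EM (trunc B' K c); last first.
    by apply: lognull_sub (@lognull0 R) => n _ /andP[/asboolP].
  by apply: lognull_sub (factor_null B'c) => n _ /andP[].
rewrite (splitr e); apply: ulog_sub (ulogU (nF _ e2) HJ) => n _ /andP[/multsP[c tc cn] nJ].
have [mB|nB] := boolP (mults B n); first by rewrite nJ orbT.
apply/orP; left; apply/hasP; exists c; first by rewrite mem_iota add0n ltnS; case: tc.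
by apply/and3P; split => //; apply/asboolP.
Qed.

Lemma ulog_dvd q : (0 < q)%N -> ulog (dvdn q) (q%:R^-1 : R).
Proof.
move=> q0; have p : has_period q (dvdn q) by move=> n; rewrite dvdn_addl.
have := ulog_periodic R q0 p; rewrite /dens /cnt big_ltn // big1_seq.
  by rewrite dvdn0 addn0 mul1r.
move=> i /andP[_]; rewrite mem_index_iota => /andP[i0 iq].
by rewrite gtnNdvd.
Qed.

Lemma high_power W e : 0 < e -> exists2 E, (0 < E)%N &
  ulog (fun n => has (fun p => prime p && (p ^ E %| n)%N) (iota 0 W.+2)) e.
Proof.
move=> e0; pose E := (Num.truncn (W.+2%:R / e)).+1; exists E => //.
have EE : W.+2%:R / e < E%:R by exact: truncnS_gt.
have E0 : 0 < E%:R :> R by rewrite ltr0n.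
have Ei : 0 <= (E%:R)^-1 :> R by rewrite invr_ge0 ltW.
have key p : p \in iota 0 W.+2 -> ulog (fun n => prime p && (p ^ E %| n)%N) (E%:R^-1 : R).
  move=> _; have [pp|np] := boolP (prime p); last first.
    apply: (@ulog_sub _ _ xpred0) => //; apply: ulog_le Ei _.
    by exists 0 => x x0; rewrite mul0r addr0 /harm big_pred0_eq.
  have pE : (0 < p ^ E)%N by rewrite expn_gt0 prime_gt0.
  apply: ulog_le (ulog_dvd pE); rewrite lef_pV2 ?posrE ?ltr0n // ler_nat.
  by apply: ltnW; apply: ltn_expl; exact: prime_gt1.
have := ulog_has Ei key; rewrite size_iota; apply: ulog_le.
rewrite ler_pdivrMr //; move: EE; rewrite ltr_pdivrMr // => /ltW.
by rewrite mulrC.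
Qed.
End TautificationPatterns.

(** * Blocks of taut sets *)

Lemma dvdn_absz_mod (x : int) (L j d : nat) : (0 < L)%N -> (d %| L)%N ->
  (d %| `|(x + j%:Z)%R|)%N = (d %| `|(x %% L)%Z| + j)%N.
Proof.
move=> L0 dL.
have L0z : L%:Z != 0 :> int by rewrite -lt0n.
have e : (`|(x %% L)%Z|%N : int) = (x %% L)%Z by rewrite gez0_abs // modz_ge0.
have -> : (d %| `|(x %% L)%Z| + j)%N = (d%:Z %| (x %% L)%Z + j%:Z)%Z.
  by rewrite -e dvdzE.
rewrite -[(d %| `|(x + j%:Z)%R|)%N]/(d%:Z %| x + j%:Z)%Z {1}(divz_eq x L) -addrA.
by rewrite rpredDl // dvdz_mull // dvdzE.
Qed.

Lemma gcdn_absz_mod (x : int) (L j : nat) : (0 < L)%N ->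
  gcdn `|(x + j%:Z)%R|%N L = gcdn (`|(x %% L)%Z| + j) L.
Proof.
move=> L0; apply/eqP; rewrite eqn_dvd !dvdn_gcd !dvdn_gcdr !andbT.
by rewrite -(@dvdn_absz_mod x L) ?dvdn_gcdr // dvdn_gcdl /= (@dvdn_absz_mod x L)
  ?dvdn_gcdr ?dvdn_gcdl.
Qed.

Lemma distn_bounds i j W : (i <= W)%N -> (j <= W)%N -> i != j ->
  (0 < `|(i%:Z - j%:Z)%R| <= W)%N.
Proof. lia. Qed.

Section Lift.
Variable R : realType.
Variables (B : set nat) (hB : B `<=` posN).
Implicit Types (C : set nat) (e : R).
Local Notation B' := (tautification R B).

(** The hypothesis provides long copies of [eta C] in [eta B], at an uncontrolled
    location k.  Since the exceptional set G below is periodic, a suitable time t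
    can be chosen from the residue of k alone, before the length of the copy is
    fixed. *)
Lemma pattern_lift C N : C `<=` posN -> behrend_closed R C ->
  (forall Y : nat, exists k : int, forall n : nat, (n <= Y)%N ->
     mults C n = mults B `|(n%:Z + k)%R|%N) ->
  exists k : nat, forall j, (j <= 2 * N)%N ->
    mults C `|j%:Z - N%:Z|%N = mults B' (k + j).
Proof.
move=> Cp clC HY.
have q : (0 : R) < 1 / 4 by rewrite divr_gt0.
have [u [k1 [u0 k10 zP oP]]] := free_pattern N Cp clC q.
pose W := (2 * N)%N; pose P := (W.+1)`!; have P0 : (0 < P)%N by exact: fact_gt0.
have prP p : prime p -> (p %| P)%N = (p <= W.+1)%N.
  move=> pp; apply/idP/idP => [pP|pW].
    by have := pnatP _ P0 (upto_nat_fact W.+1) p pp pP.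
  by rewrite dvdn_fact // prime_gt0.
(* The exceptional set will be translated by W + 1 positions and sampled along a
   progression of step u, whence the denominator. *)
pose eG : R := (1 / 2) / (W.+1%:R * u.+1%:R).
have WR : 0 < W.+1%:R :> R by rewrite ltr0n.
have uR : 0 < u.+1%:R :> R by rewrite ltr0n.
have eG0 : 0 < eG by rewrite divr_gt0 ?mulr_gt0.
have eG2 : 0 < eG / 2 by rewrite divr_gt0.
have [E E0 HE] := high_power W eG2.
pose K := (P ^ E)%N; have K0 : (0 < K)%N by rewrite expn_gt0 P0.
have [J HJ] := uniform_trunc hB K eG2.
pose G n := mults (trunc B' K) n && ~~ mults (trunc B J) n ||
   has (fun p => prime p && (p ^ E %| n)%N) (iota 0 W.+2).
have uG : ulog G eG by rewrite (splitr eG); exact: ulogU.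
have /choice[tf Htf] : forall r, exists t, [/\ (0 < t)%N,
   forall j, j \in ones C N -> ~~ mults C (k1 + u * t + j) &
   forall j, (j <= W)%N -> ~~ G (r + (k1 + u * t + j))%N].
  move=> r.
  have bad : ulog (fun t => has (fun j => G (r + k1 + j + u * t)%N) (iota 0 W.+1)) (1 / 2 : R).
    have key j : j \in iota 0 W.+1 ->
        ulog (fun t => G (r + k1 + j + u * t)%N) (u.+1%:R * eG).
      move=> _; apply: (ulog_comp (t0 := r + k1 + j) (@addMn_inj (r + k1 + j) _ u0) _ _ uG).
        by move=> t _; rewrite !addn_gt0 k10 orbT.
      by move=> t ht; rewrite mulSn leq_add2r.
    apply: ulog_le (ulog_has _ key); last by rewrite mulr_ge0 // ltW.
    rewrite size_iota /eG le_eqVlt; apply/orP; left; apply/eqP.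
    move: (lt0r_neq0 WR) (lt0r_neq0 uR); move: (W.+1%:R) (u.+1%:R) => a b a0 b0.
    by field; rewrite a0 b0.
  have lt1 : 1 / 4 + 1 / 2 < (1 : R) by lra.
  have [t t0] := ulog_exists lt1 (ulogU oP bad).
  rewrite negb_or => /andP[/hasPn ot /hasPn bt]; exists t; split => // j jW.
  have -> : (r + (k1 + u * t + j) = r + k1 + j + u * t)%N by ring.
  by apply: bt; rewrite mem_iota add0n ltnS.
(* Pi is a period of G, so the location k matters only modulo Pi. *)
pose Pi := (K * (K`! * J`!))%N.
have Pi0 : (0 < Pi)%N by rewrite /Pi 2!muln_gt0 K0 !fact_gt0.
pose X := \max_(r < Pi) tf r.
have [k Hk] := HY (k1 + u * X + W)%N.
pose r := `|(k %% Pi)%Z|%N.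
have rPi : (r < Pi)%N.
  rewrite /r -ltz_nat gez0_abs ?modz_ge0 ?ltz_pmod // -lt0n //.
have tX : (tf r <= X)%N by rewrite /X (leq_bigmax (Ordinal rPi)).
have [t0 Ht HG] := Htf r.
pose base := (k1 + u * tf r)%N.
rewrite -/base in Ht HG.
pose z j := `|((base + j)%N%:Z + k)%R|%N.
have zr d j : (d %| Pi)%N -> (d %| z j)%N = (d %| r + (base + j))%N.
  by move=> dPi; rewrite /z addrC (dvdn_absz_mod k (base + j) Pi0 dPi).
have CB j : (j <= W)%N -> mults C `|j%:Z - N%:Z|%N = mults B (z j).
  move=> jW; rewrite /z -Hk; last first.
    by rewrite /base leq_add // leq_add2l leq_mul2l tX orbT.
  have [mj|nmj] := boolP (mults C `|j%:Z - N%:Z|%N).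
    have [|c Cc cd] := zP j; first by rewrite zerosE jW.
    by apply/esym/multsP; exists c => //; exact: cd.
  by apply/esym/negbTE; apply: Ht; rewrite onesE jW.
have truncz D M j : D `<=` posN -> (M`! %| Pi)%N ->
    mults (trunc D M) (z j) = mults (trunc D M) (r + (base + j)).
  move=> Dp dM; have dd a : trunc D M a -> (a %| Pi)%N.
    by move=> [Da aM]; apply: dvdn_trans dM; rewrite dvdn_fact // aM andbT; exact: Dp.
  by apply/multsP/multsP => -[a ta az]; exists a => //; move: az; rewrite zr //; exact: dd.
have z_pow p j : prime p -> (p <= W.+1)%N -> (j <= W)%N -> ~~ (p ^ E %| z j)%N.
  move=> pp pW jW; rewrite zr; last first.
    by rewrite /Pi dvdn_mulr // /K dvdn_exp2r // prP.
  have := HG j jW; rewrite negb_or => /andP[_ /hasPn/(_ p)].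
  by rewrite mem_iota add0n ltnS pW pp => /(_ isT).
have z_free j : j \in ones C N -> ~~ mults (trunc B' K) (z j).
  rewrite onesE => /andP[jW nC].
  have nB : ~~ mults B (z j) by rewrite -CB.
  have := HG j jW; rewrite negb_or => /andP[+ _]; rewrite negb_and negbK.
  have dK : (K`! %| Pi)%N by rewrite /Pi mulnCA dvdn_mulr.
  have dJ : (J`! %| Pi)%N by rewrite /Pi mulnA dvdn_mull.
  rewrite -(truncz _ K j (tautification_posN hB) dK) -(truncz _ J j hB dJ).
  by move=> /orP[//|/(sub_mults (@trunc_sub _ _))]; rewrite (negPf nB).
have /choice[bf Hbf] : forall j, exists b, (0 < b)%N /\
    (j \in zeros C N -> B b /\ (b %| z j)%N).
  move=> j.
  have [jz|njz] := boolP (j \in zeros C N); last by exists 1%N.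
  move: (jz); rewrite zerosE => /andP[jW]; rewrite CB // => /multsP[b Bb bz].
  by exists b; split => //; exact: hB.
(* L forces the zeros at the same positions; k0 represents the location of the
   copy modulo L. *)
pose L := (K * \prod_(j <- zeros C N) bf j)%N.
have L0 : (0 < L)%N.
  rewrite /L muln_gt0 K0 /=; elim/big_ind: _ => // [a b a0 b0|j _].
    by rewrite muln_gt0 a0.
  by case: (Hbf j).
have bfL j : j \in zeros C N -> (bf j %| L)%N.
  move=> jz; rewrite /L (bigD1_seq j) ?filter_uniq ?iota_uniq //=.
  by rewrite dvdn_mull // dvdn_mulr.
pose k0 := `|((base%:Z + k)%R %% L)%Z|%N.
have zE j : z j = `|(base%:Z + k + j%:Z)%R|%N by rewrite /z PoszD addrAC.
have gE j : gcdn (k0 + j) L = gcdn (z j) L by rewrite zE gcdn_absz_mod.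
have prK p : prime p -> (p %| K)%N = (p <= W.+1)%N.
  by move=> pp; rewrite /K Euclid_dvdX // E0 andbT prP.
(* Two positions of the window differ by at most W. *)
have big_prime j p : j \in ones C N -> prime p -> (p %| L)%N -> (p %| z j)%N -> (p <= W.+1)%N.
  rewrite onesE => /andP[jW nC] pp; rewrite /L Euclid_dvdM // prK // => /orP[//|].
  move=> pprod pz; have [i iz pb] : exists2 i, i \in zeros C N & (p %| bf i)%N.
    elim: (zeros C N) pprod => [|i s IHs]; first by rewrite big_nil Euclid_dvd1.
    rewrite big_cons Euclid_dvdM // => /orP[pi|/IHs[l ls pl]].
      by exists i; rewrite ?mem_head.
    by exists l; rewrite // inE ls orbT.
  have [_ /(_ iz)[_ bz]] := Hbf i.
  have pzi := dvdn_trans pb bz.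
  move: (iz); rewrite zerosE => /andP[iW mC].
  have ij : i != j by apply: contraNneq nC => <-.
  have : (p %| `|(i%:Z - j%:Z)%R|)%N.
    have -> : i%:Z - j%:Z = ((base + i)%:Z + k) - ((base + j)%:Z + k) by rewrite !PoszD; ring.
    by rewrite -[(_ %| _)%N]/(p%:Z %| _)%Z rpredB // dvdzE.
  have /andP[d0 dW] := distn_bounds iW jW ij.
  by move=> /(dvdn_leq d0) pd; exact: leqW (leq_trans pd dW).
have log_lt j p : j \in ones C N -> prime p -> (p %| L)%N ->
    (logn p (gcdn (z j) L) < logn p L)%N.
  move=> jo pp pL; have [pz|npz] := boolP (p %| z j)%N; last first.
    have -> : logn p (gcdn (z j) L) = 0%N.
      apply/eqP; rewrite -leqn0 leqNgt logn_gt0 mem_primes; apply/negP => /and3P[_ _].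
      by rewrite dvdn_gcd (negPf npz).
    by rewrite logn_gt0 mem_primes pp L0.
  have pW := big_prime j p jo pp pL pz.
  have jW : (j <= W)%N by move: jo; rewrite onesE => /andP[].
  have g0 : (0 < gcdn (z j) L)%N by rewrite gcdn_gt0 L0 orbT.
  apply: (@leq_trans E).
    rewrite ltnNge -pfactor_dvdn //; apply: contra (z_pow p j pp pW jW) => h.
    exact: dvdn_trans h (dvdn_gcdl _ _).
  by rewrite -pfactor_dvdn // /L dvdn_mulr // /K dvdn_exp2r // prP.
have gK j : j \in ones C N -> (gcdn (z j) L %| K)%N.
  move=> jo; have g0 : (0 < gcdn (z j) L)%N by rewrite gcdn_gt0 L0 orbT.
  have jW : (j <= W)%N by move: jo; rewrite onesE => /andP[].
  rewrite -(partnT g0) -(partnT K0); apply/dvdn_partP; rewrite ?part_gt0 // => p.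
  rewrite partnT // mem_primes => /and3P[pp _ pg]; rewrite p_part partnT //.
  have pz := dvdn_trans pg (dvdn_gcdl _ _); have pL := dvdn_trans pg (dvdn_gcdr _ _).
  have pW := big_prime j p jo pp pL pz.
  apply: (@dvdn_trans (p ^ E)); last by rewrite /K dvdn_exp2r // prP.
  apply: dvdn_exp2l; rewrite leqNgt; apply/negP => lt.
  have := z_pow p j pp pW jW; rewrite (dvdn_trans _ (dvdn_gcdl (z j) L)) //.
  by rewrite pfactor_dvdn // ltnW.
have half : (0 : R) < 1 / 2 by rewrite divr_gt0.
have [|||||u2 [k2 [u20 k20 Lu kk uk]]] :=
  @free_window R B' (ones C N) W k0 L (1 / 2) (tautification_posN hB)
    (tautification_closed hB) L0.
- by move=> j; rewrite onesE => /andP[].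
- by move=> p pp pW; rewrite /L dvdn_mulr // prK.
- move=> j jo; rewrite gE; apply: contra (z_free j jo) => /multsP[c B'c cg].
  apply/multsP; exists c; last exact: dvdn_trans cg (dvdn_gcdl _ _).
  by split => //; apply: dvdn_leq K0 (dvdn_trans cg (gK j jo)).
- move=> j jo p pp pL; rewrite gE; have := log_lt j p jo pp pL.
  rewrite -subn_gt0 -logn_div ?dvdn_gcdr // logn_gt0 mem_primes => /and3P[] //.
- exact: half.
have lt1 : (1 / 2 : R) < 1 by lra.
have [t2 t20 /hasPn h2] := ulog_exists lt1 uk.
exists (k2 + u2 * t2)%N => j jW.
have [mj|nmj] := boolP (mults C `|j%:Z - N%:Z|%N); last first.
  by apply/esym/negbTE; apply: h2; rewrite onesE jW.
apply/esym/(@sub_mults_tautification R B hB); have jz : j \in zeros C N by rewrite zerosE jW.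
have [_ /(_ jz)[Bb bz]] := Hbf j; apply/multsP; exists (bf j) => //.
rewrite (dvdn_eqmod (bfL j jz) (_ : _ = k0 + j %[mod L])%N).
  by rewrite -(dvdn_absz_mod _ _ L0 (bfL j jz)) -zE.
have /dvdnP[v ->] := Lu.
have -> : (k2 + v * L * t2 + j = v * t2 * L + (k2 + j))%N by ring.
by rewrite modnMDl -(modnDml k2) kk modnDml.
Qed.
End Lift.

(** * Orbit closures *)

Lemma nbhs_coord (y : config) (n : int) : nbhs y [set f : config | f n = y n].
Proof.
have := @proj_continuous int (fun=> bool) n y.
move=> /(_ [set b | b = y n]); apply.
exact: discrete_set1.
Qed.

Lemma nbhs_window (y : config) (N : nat) :
  nbhs y [set f : config | forall n : int, (`|n| <= N)%N -> f n = y n].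
Proof.
elim: N => [|N IHN].
  apply: filterS (nbhs_coord y 0) => f fy n n0.
  by have -> : n = 0 by lia.
apply: filterS (filterI IHN (filterI (nbhs_coord y N.+1%:Z) (nbhs_coord y (- N.+1%:Z)))).
move=> f [H [/= H1 H2]] n nN; have [/H //|lt] := leqP `|n|%N N.
by have [->|->] : n = N.+1%:Z \/ n = - N.+1%:Z by lia.
Qed.

(** Basic neighbourhoods in the product topology constrain finitely many
    coordinates. *)
Lemma orbit_closureP (x y : config) : orbit_closure x y <->
  forall N : nat, exists k : int, forall n : int, (`|n| <= N)%N -> y n = x (n + k).
Proof.
split=> [cl N|H].
  have [_ [[k _ <-] Hk]] := cl _ (nbhs_window y N).
  by exists k => n nN; rewrite -Hk.
have [kf Hkf] := choice H; pose g (N : nat) : config := sigma_pow (kf N) x.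
have gcvg : g @ \oo --> y.
  apply/cvg_sup => n U [V] [[W] oW <-] WfN WU.
  apply: (filterS WU); rewrite nbhs_simpl /g; exists `|n|%N => // i /= ni.
  by rewrite /preimage /= /sigma_pow -Hkf.
move=> A /gcvg; rewrite nbhs_simpl => -[N _ An].
by exists (g N); split; [exists (kf N) | apply: An => /=].
Qed.

Lemma orbit_closure_sub (x y : config) : orbit_closure x y ->
  orbit_closure y `<=` orbit_closure x.
Proof.
move=> /orbit_closureP xy z /orbit_closureP yz; apply/orbit_closureP => N.
have [k Hk] := yz N; have [l Hl] := xy (N + `|k|)%N.
exists (k + l) => n nN; rewrite Hk // Hl ?addrA //; move: nN.
by lia.
Qed.

Lemma orbit_closure_refl (x : config) : orbit_closure x x.
Proof. by apply/orbit_closureP => N; exists 0 => n _; rewrite addr0. Qed.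

Lemma etaE (A : set nat) (n : int) : eta A n = ~~ mults A `|n|%N.
Proof.
rewrite /eta /free_set; apply/idP/idP => [/set_mem H|H].
  apply/negP => /multsP[a Aa an]; apply: H; exists a => //.
  have /dvdzP[q ->] : (a%:Z %| n)%Z by rewrite dvdzE.
  by exists q => //; rewrite mulrC.
apply/mem_set => -[a Aa [k _ kn]]; move/negP: H; apply; apply/multsP; exists a => //.
by rewrite -kn abszM dvdn_mulr.
Qed.

Lemma eta_orbit_closure (A D : set nat) :
  (forall N, exists k : nat, forall j, (j <= 2 * N)%N ->
     mults A `|j%:Z - N%:Z|%N = mults D (k + j)) ->
  orbit_closure (eta D) (eta A).
Proof.
move=> H; apply/orbit_closureP => N; have [k Hk] := H N.
exists (k + N)%N%:Z => n nN; rewrite !etaE; congr negb.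
have [j jE] : exists j : nat, n = j%:Z - N%:Z by exists `|(n + N%:Z)%R|%N; lia.
have j2 : (j <= 2 * N)%N by lia.
by rewrite jE Hk //; congr mults; lia.
Qed.

Theorem corollaryE (R : realType) (B : set nat) (hB : B `<=` posN) :
  is_largest prec (Taut R B) (tautification R B).
Proof.
split.
  split; first exact: tautification_taut.
  apply/orbit_closure_sub/eta_orbit_closure => N.
  exact: pattern_tautification.
move=> C [tC CB]; apply/orbit_closure_sub/eta_orbit_closure => N.
apply: (@pattern_lift R B hB C N tC.1 (taut_behrend_closed tC)) => Y.
have /orbit_closureP/(_ Y)[k Hk] := CB _ (@orbit_closure_refl (eta C)).
exists k => n nY; apply: negb_inj; have := Hk n%:Z; rewrite !etaE; exact.
Qed.
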